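(* Let $(P,Q)$ be a pair of orthogonal projections on a Hilbert space $\mathcal{H}$. There exists a direct rotation $S$ from $P$ to $Q$, i.e. a unitary $S\in\mathcal{U}(\mathcal{H})$ satisfying $$SP=QS,\qquad S^2=(Q^\perp-Q)(P^\perp-P),\qquad \mathrm{Re}\,S\ge 0,$$ if and only if $\dim(\mathcal{R}(P)\cap\mathcal{N}(Q))=\dim(\mathcal{N}(P)\cap\mathcal{R}(Q))$. Moreover, suppose $\dim(\mathcal{R}(P)\cap\mathcal{N}(Q))=\dim(\mathcal{N}(P)\cap\mathcal{R}(Q))$ and that $P$ and $Q$ have the operator matrices $$P=I_1\oplus I_2\oplus 0I_3\oplus 0I_4\oplus I_5\oplus 0I_6,$$ $$Q=I_1\oplus 0I_2\oplus I_3\oplus 0I_4\oplus\begin{pmatrix} Q_0 & Q_0^{1/2}(I_5-Q_0)^{1/2}D\\ D^*Q_0^{1/2}(I_5-Q_0)^{1/2} & D^*(I_5-Q_0)D\end{pmatrix}$$ with respect to the decomposition $\mathcal{H}=\bigoplus_{i=1}^6\mathcal{H}_i$ described in the context. Then the direct rotations from $P$ to $Q$ are precisely the operators $$S=I_1\oplus\begin{pmatrix}0&C\\-C^*&0\end{pmatrix}\oplus I_4\oplus\begin{pmatrix}Q_0^{1/2} & -(I_5-Q_0)^{1/2}D\\ D^*(I_5-Q_0)^{1/2} & D^*Q_0^{1/2}D\end{pmatrix}$$ with respect to $\mathcal{H}=\mathcal{H}_1\oplus(\mathcal{H}_2\oplus\mathcal{H}_3)\oplus\mathcal{H}_4\oplus(\mathcal{H}_5\oplus\mathcal{H}_6)$,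 where $C$ is an arbitrary unitary from $\mathcal{H}_3$ onto $\mathcal{H}_2$.
   Context: $\mathcal{U}(\mathcal{H})$ is the set of unitary operators on $\mathcal{H}$; $\mathcal{R}(A)$ and $\mathcal{N}(A)$ denote the range and null space of $A$; $\dim$ is Hilbert space dimension; $\mathrm{Re}\,A=\frac12(A+A^* )$; $A\ge0$ means $(Ax,x)\ge 0$ for all $x\in\mathcal{H}$. An orthogonal projection is a bounded operator $P$ with $P=P^*=P^2$, and $P^\perp=I-P$. Decomposition: $\mathcal{H}_1=\mathcal{R}(P)\cap\mathcal{R}(Q)$, $\mathcal{H}_2=\mathcal{R}(P)\cap\mathcal{N}(Q)$, $\mathcal{H}_3=\mathcal{N}(P)\cap\mathcal{R}(Q)$, $\mathcal{H}_4=\mathcal{N}(P)\cap\mathcal{N}(Q)$, $\mathcal{H}_5=\mathcal{R}(P)\ominus(\mathcal{H}_1\oplus\mathcal{H}_2)$, $\mathcal{H}_6=\mathcal{H}\ominus\bigoplus_{j=1}^5\mathcal{H}_j$ (some of these may be $\{0\}$). $I_i$ is the identity on $\mathcal{H}_i$; $Q_0$ is a positive contraction on $\mathcal{H}_5$ for which neither $0$ nor $1$ is an eigenvalue; $D$ is a unitary from $\mathcal{H}_6$ onto $\mathcal{H}_5$. It is a known fact that every pair of orthogonal projections admits operator matrices of this form. *)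

(* Defs.v *)
From mathcomp Require Import all_boot all_order all_algebra.
From mathcomp Require Import sesquilinear complex.
From mathcomp Require Import all_classical all_reals topology normedtype.

Set Implicit Arguments.
Unset Strict Implicit.
Unset Printing Implicit Defensive.

Import Order.TTheory GRing.Theory Num.Theory.
Import numFieldNormedType.Exports.

Local Open Scope classical_set_scope.
Local Open Scope ring_scope.

(* A complex Hilbert space is a complete normed module H over R[i] whose norm
   is induced by a positive definite Hermitian form ip, linear in its first
   argument: see [hilbert_norm]. *)

Section Hilbert.
Context (R : realType) (H : completeNormedModType R[i]).
Context (ip : {dot H for @Num.conj R[i]}).
Implicit Types (M N E : set H) (A T U P Q S : H -> H).

Definition hilbert_norm := forall x : H, `|x| ^+ 2 = ip x x.

(* An operator from a subspace M to a subspace N is a function H -> H of which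
   only the values on M are relevant: two such functions denote the same
   operator when they agree on M.  Operators on H itself are the case
   M = N = setT, where this is plain equality of functions. *)
Definition bounded_op M N A :=
  [/\ forall x, M x -> N (A x),
      forall (a : R[i]) x y, M x -> M y -> A (a *: x + y) = a *: A x + A y
    & exists k : R[i], forall x, M x -> `|A x| <= k * `|x| ].

Definition is_adj_op M N A B :=
  (forall y, N y -> M (B y)) /\
  (forall x y, M x -> N y -> ip (A x) y = ip x (B y)).

(* The adjoint is unique as an operator from N to M, and exists when A is
   bounded and M, N are closed; 0 is only a default value. *)
Definition adj_op M N A : H -> H := xget 0 (is_adj_op M N A).

Definition unitary_op M N U :=
  [/\ bounded_op M N U,
      forall x, M x -> adj_op M N U (U x) = x
    & forall y, N y -> U (adj_op M N U y) = y].

Definition positive_op M A := forall x, M x -> 0 <= ip (A x) x.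

Definition is_sqrt M A B :=
  [/\ bounded_op M M B, positive_op M B & forall x, M x -> B (B x) = A x].

(* The positive square root, unique as an operator on M. *)
Definition op_sqrt M A : H -> H := xget 0 (is_sqrt M A).

Definition op_eigenvalue M A (l : R[i]) :=
  exists x, [/\ M x, x != 0 & A x = l *: x].

Definition positive_contraction M A :=
  [/\ bounded_op M M A, positive_op M A & forall x, M x -> `|A x| <= `|x| ].

Definition op_ker A : set H := [set x | A x = 0].

Definition re_op S : H -> H := 2^-1 *: (S + adj_op setT setT S).

Definition orthogonal_projection P :=
  [/\ bounded_op setT setT P, P = adj_op setT setT P & P = P \o P].

Definition perp P : H -> H := idfun - P.

Definition direct_rotation P Q S :=
  [/\ unitary_op setT setT S,
      S \o P = Q \o S,
      S \o S = (perp Q - Q) \o (perp P - P)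
    & positive_op setT (re_op S)].

Definition orthonormal_basis M E :=
  [/\ E `<=` M,
      forall e f, E e -> E f -> ip e f = (e == f)%:R
    & forall x, M x -> (forall e, E e -> ip x e = 0) -> x = 0].

(* dim M = dim N, for the Hilbert space dimension, i.e. the cardinality of an
   orthonormal basis: all the orthonormal bases of a closed subspace are
   equipotent. *)
Definition eq_hdim M N :=
  exists E F, [/\ orthonormal_basis M E, orthonormal_basis N F & (E #= F)%card].

Definition dsum M N : set H := [set x + y | x in M & y in N].

Definition ominus M N : set H :=
  [set x | M x /\ forall y, N y -> ip x y = 0].

Section Decomposition.
Context (P Q : H -> H).

Definition H1 := range P `&` range Q.
Definition H2 := range P `&` op_ker Q.
Definition H3 := op_ker P `&` range Q.
Definition H4 := op_ker P `&` op_ker Q.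
Definition H5 := ominus (range P) (dsum H1 H2).
Definition H6 :=
  ominus setT (dsum (dsum (dsum (dsum H1 H2) H3) H4) H5).

Definition decomposition : seq (set H) := [:: H1; H2; H3; H4; H5; H6].

End Decomposition.

(* T has the operator matrix B with respect to H = \bigoplus_j M_j; the entry
   in row i and column j is an operator from M_j to M_i. *)
Definition has_opmx (M : seq (set H)) (B : seq (seq (H -> H))) T :=
  let n := size M in
  let b i j : H -> H := nth 0 (nth [::] B i) j in
  (forall i j : 'I_n, forall x, nth set0 M j x -> nth set0 M i (b i j x)) /\
  (forall x : 'I_n -> H, (forall j : 'I_n, nth set0 M j (x j)) ->
     T (\sum_(j < n) x j) = \sum_(i < n) \sum_(j < n) b i j (x j)).

Definition P_opmx : seq (seq (H -> H)) :=
  let I : H -> H := idfun in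
  [:: [:: I; 0; 0; 0; 0; 0];
      [:: 0; I; 0; 0; 0; 0];
      [:: 0; 0; 0; 0; 0; 0];
      [:: 0; 0; 0; 0; 0; 0];
      [:: 0; 0; 0; 0; I; 0];
      [:: 0; 0; 0; 0; 0; 0]].

Definition Q_opmx (M5 M6 : set H) (Q0 D : H -> H) : seq (seq (H -> H)) :=
  let I : H -> H := idfun in
  let r := op_sqrt M5 Q0 in
  let r' := op_sqrt M5 (I - Q0) in
  let D' := adj_op M6 M5 D in
  [:: [:: I; 0; 0; 0; 0;             0                     ];
      [:: 0; 0; 0; 0; 0;             0                     ];
      [:: 0; 0; I; 0; 0;             0                     ];
      [:: 0; 0; 0; 0; 0;             0                     ];
      [:: 0; 0; 0; 0; Q0;            r \o r' \o D          ];
      [:: 0; 0; 0; 0; D' \o r \o r'; D' \o (I - Q0) \o D   ]].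

Definition S_opmx (M2 M3 M5 M6 : set H) (Q0 D C : H -> H) :
    seq (seq (H -> H)) :=
  let I : H -> H := idfun in
  let r := op_sqrt M5 Q0 in
  let r' := op_sqrt M5 (I - Q0) in
  let D' := adj_op M6 M5 D in
  let C' := adj_op M3 M2 C in
  [:: [:: I; 0;    0; 0; 0;        0            ];
      [:: 0; 0;    C; 0; 0;        0            ];
      [:: 0; - C'; 0; 0; 0;        0            ];
      [:: 0; 0;    0; I; 0;        0            ];
      [:: 0; 0;    0; 0; r;        - (r' \o D)  ];
      [:: 0; 0;    0; 0; D' \o r'; D' \o r \o D ]].

End Hilbert.

(* Main.v *)
From HB Require Import structures.
Require Import Defs.
From mathcomp Require Import all_boot all_order all_algebra.
From mathcomp Require Import sesquilinear complex ring lra.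
From mathcomp Require Import all_classical all_reals topology normedtype.

Set Implicit Arguments.
Unset Strict Implicit.
Unset Printing Implicit Defensive.

Import Order.TTheory GRing.Theory Num.Theory.
Import numFieldNormedType.Exports.
Local Open Scope classical_set_scope.
Local Open Scope ring_scope.

(** For a pair of projections put T := QP + (1-Q)(1-P) and A := 1 - (P-Q)^2.
    Three polynomial identities carry the whole argument:
      T* T = T T* = A,    T + T* = 2 A,    2 T - 1 = (1-2Q)(1-2P),
    where T* is T with P and Q exchanged.  Let B be the positive square root
    of A, the cosine of the angle operator.  Both A and B commute with P and
    Q, and their common kernel is H2 + H3, where H2 = ran P /\ ker Q and
    H3 = ker P /\ ran Q.

    If S is a direct rotation then S^2 = 2T - 1, so the positive operator
    Re S = (S + S* )/2 has square (T + T* )/2 = A, hence equals B, and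
    S B = S (S + S* )/2 = (S^2 + 1)/2 = T [direct_rotation_cos].  This
    determines S on the closure of the range of B, the orthogonal complement of
    ker B.  On the kernel T vanishes, so S^2 = -1 there,
    and S P = Q S makes S exchange H2 and H3: it is (0, C; -C*, 0) for the
    unitary C := S|H3 : H3 -> H2 [direct_rotation_unitary].  Conversely, for
    any unitary C from H3 to H2 the relation B v + u |-> T v + (C - C* ) u,
    with u in the kernel of B, is isometric with dense domain and dense range,
    so it extends to a unitary S [isometric_extension], and the three
    identities make S a direct rotation [direct_rotation_of, rotation_exists].

    Direct rotations therefore correspond to unitaries from H3 onto H2.  Such a
    unitary exists exactly when H2 and H3 have equipotent orthonormal bases:
    it transports a basis obtained from Zorn's lemma, and conversely a
    bijection of bases induces an isometry of the spans to which the same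
    extension result applies [direct_rotation_exists_iff].

    For the operator matrices, reading A off the matrix of Q gives Q0 on H5 and
    D* Q0 D on H6, and A = 1 on H1 and H4.  By uniqueness of positive square
    roots, B is the identity on H1 and H4, Q0^(1/2) on H5 and D* Q0^(1/2) D on
    H6.  On each of these four subspaces the column of the claimed matrix is a
    vector y orthogonal to ker B with B y = T x, which characterises S x
    [direct_rotation_generic]; the remaining two columns are the action of C
    and -C* on the kernel.

    The analytic input is the projection theorem, the existence of positive
    square roots by monotone iteration, and their uniqueness. *)

(** * Inner products and real parts *)

Section InnerProduct.
Context (R : realType) (H : completeNormedModType R[i]).
Context (ip : {dot H for @Num.conj R[i]}).
Implicit Types (x y z : H) (a : R[i]).

Lemma ipC x y : ip x y = (ip y x)^*.
Proof. by rewrite hermC /= expr0 mul1r. Qed.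

Lemma ip_ext x y : (forall z, ip x z = ip y z) -> x = y.
Proof.
move=> h; apply/eqP; rewrite -subr_eq0 -(dnorm_eq0 ip).
by rewrite linearBl /= h subrr.
Qed.

Lemma ipDl x y z : ip (x + y) z = ip x z + ip y z.
Proof. exact: linearDl. Qed.
Lemma ipDr x y z : ip x (y + z) = ip x y + ip x z.
Proof. exact: linearDr. Qed.
Lemma ipNl x z : ip (- x) z = - ip x z. Proof. exact: linearNl. Qed.
Lemma ipNr x z : ip x (- z) = - ip x z. Proof. exact: linearNr. Qed.
Lemma ipZl a x z : ip (a *: x) z = a * ip x z. Proof. exact: linearZl_LR. Qed.
Lemma ipZr a x z : ip x (a *: z) = a^* * ip x z. Proof. exact: linearZr_LR. Qed.
Lemma ip0l z : ip 0 z = 0. Proof. exact: linear0l. Qed.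
Lemma ip0r z : ip z 0 = 0. Proof. exact: linear0r. Qed.

Definition ipE := (ipDl, ipDr, ipNl, ipNr, ipZl, ipZr, ip0l, ip0r).

Lemma ip_eq0 x : ip x x = 0 -> x = 0.
Proof. by move/eqP; rewrite (dnorm_eq0 ip) => /eqP. Qed.

Lemma ip_sym0 x y : ip x y = 0 -> ip y x = 0.
Proof. by rewrite ipC => h; rewrite -[ip y x]conjCK h conjC0. Qed.

End InnerProduct.

(** Linear identities between vectors are reduced to commutative ring
    identities between scalars by pairing both sides with an arbitrary vector. *)
Ltac vec ip := rewrite ?(linearD, linearN, linearZ, linear0) /=;
  apply: (@ip_ext _ _ ip) => ?; rewrite !ipE; ring.

Section RealGeometry.
Local Open Scope complex_scope.
Context (R : realType) (H : completeNormedModType R[i]).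
Context (ip : {dot H for @Num.conj R[i]}) (hH : hilbert_norm ip).
Implicit Types (x y z : H) (a : R[i]) (t : R).

(** The norm takes values in R[i], whose order is partial; estimates are made
    with its real part, where linear arithmetic is available. *)
Definition normR x : R := complex.Re `|x|.

Lemma normRE x : `|x| = (normR x)%:C.
Proof.
by rewrite /normR; have := normr_ge0 x; case: `|x| => u v; rewrite lecE /= => /andP[/eqP-> _].
Qed.

Lemma normR_ge0 x : 0 <= normR x.
Proof. by have := normr_ge0 x; rewrite normRE lecR. Qed.

Lemma normR0 : normR 0 = 0. Proof. by rewrite /normR normr0. Qed.

Lemma normRN x : normR (- x) = normR x. Proof. by rewrite /normR normrN. Qed.

Lemma normR_distC x y : normR (x - y) = normR (y - x).
Proof. by rewrite -normRN opprB. Qed.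

Lemma normR_eq0 x : normR x = 0 -> x = 0.
Proof. by move=> h; apply/eqP; rewrite -normr_eq0 normRE h. Qed.

Lemma normRD x y : normR (x + y) <= normR x + normR y.
Proof. by rewrite -lecR rmorphD /= -!normRE ler_normD. Qed.

Lemma normRB3 y x z : normR (x - z) <= normR (x - y) + normR (y - z).
Proof. by apply: le_trans (normRD _ _); rewrite addrA subrK. Qed.

Lemma normRZ t x : 0 <= t -> normR (t%:C *: x) = t * normR x.
Proof.
move=> t0; apply: (@complexI R); rewrite rmorphM /= -!normRE normrZ ger0_norm ?lecR //.
Qed.

Lemma normR_le x y : (normR x <= normR y) = (`|x| <= `|y|).
Proof. by rewrite !normRE lecR. Qed.

(** The real inner product underlying ip; it determines ip, see [ip_ipR] below. *)
Definition ipR x y : R := complex.Re (ip x y).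

Lemma ipxx x : ip x x = (normR x ^+ 2)%:C.
Proof. by rewrite -hH normRE rmorphXn. Qed.

Lemma ipRxx x : ipR x x = normR x ^+ 2. Proof. by rewrite /ipR ipxx. Qed.

Lemma ipRDl x y z : ipR (x + y) z = ipR x z + ipR y z.
Proof. by rewrite /ipR ipDl raddfD. Qed.
Lemma ipRDr x y z : ipR z (x + y) = ipR z x + ipR z y.
Proof. by rewrite /ipR ipDr raddfD. Qed.
Lemma ipRNl x z : ipR (- x) z = - ipR x z.
Proof. by rewrite /ipR ipNl raddfN. Qed.
Lemma ipRNr x z : ipR z (- x) = - ipR z x.
Proof. by rewrite /ipR ipNr raddfN. Qed.
Lemma ipRZl t x z : ipR (t%:C *: x) z = t * ipR x z.
Proof. by rewrite /ipR ipZl; case: (ip x z) => u v /=; ring. Qed.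
Lemma ipRC x y : ipR x y = ipR y x.
Proof. by rewrite /ipR ipC; case: (ip y x). Qed.
Lemma ipRZr t x z : ipR z (t%:C *: x) = t * ipR z x.
Proof. by rewrite ipRC ipRZl ipRC. Qed.

Definition ipRE := (ipRDl, ipRDr, ipRNl, ipRNr, ipRZl, ipRZr).

(** The imaginary part of ip x y is the real inner product of x with i y, which
    again lies in M. *)
Lemma ipR_ip_eq0 x (M : set H) : (forall a y, M y -> M (a *: y)) ->
  (forall y, M y -> ipR x y = 0) -> forall y, M y -> ip x y = 0.
Proof.
move=> MZ h y My; have h1 := h _ My; have := h _ (MZ (0 +i* 1) _ My).
move: h1; rewrite /ipR ipZr; case: (ip x y) => u v /= -> h2.
by congr (_ +i* _); rewrite -h2; ring.
Qed.

(** The discriminant criterion behind Cauchy-Schwarz, stated for b = 0 too so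
    that degenerate vectors need no separate treatment. *)
Lemma quadratic_ge0 (a b c : R) : 0 <= b ->
  (forall t, 0 <= a - 2 * t * c + t ^+ 2 * b) -> c ^+ 2 <= a * b.
Proof.
move=> b0 h; have [b1|b1] := eqVneq b 0.
  rewrite b1 mulr0; have [->|c0] := eqVneq c 0; first by rewrite expr0n.
  (* with b = 0 the form is affine in t; this t makes it equal to -1 *)
  have := h ((a + 1) / (2 * c)); rewrite b1.
  have -> : 2 * ((a + 1) / (2 * c)) * c = a + 1 by field.
  by move=> h1; exfalso; lra.
have bp : 0 < b by rewrite lt_def b1.
have := h (c / b).
have -> : a - 2 * (c / b) * c + (c / b) ^+ 2 * b = (a * b - c ^+ 2) / b by field.
by rewrite pmulr_lge0 ?invr_gt0 // subr_ge0.
Qed.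

Lemma ipR_CauchySchwarz x y : `|ipR x y| <= normR x * normR y.
Proof.
rewrite -(@ler_pXn2r _ 2) ?nnegrE ?mulr_ge0 ?normR_ge0 // real_normK ?num_real // exprMn.
apply: quadratic_ge0 => [|t]; first exact: sqr_ge0.
have := sqr_ge0 (normR (x - t%:C *: y)).
rewrite -!ipRxx !ipRE (ipRC y x) => h; lra.
Qed.

Lemma parallelogram x y : normR (x + y) ^+ 2 + normR (x - y) ^+ 2 =
  2 * normR x ^+ 2 + 2 * normR y ^+ 2.
Proof. by rewrite -!ipRxx !ipRE (ipRC y x); ring. Qed.

Lemma small_rate (c e : R) : 0 <= c -> 0 < e -> exists n : nat, c / n.+1%:R < e.
Proof.
move=> c0 e0; have [n hn] : exists n : nat, c / e < n%:R.
  by exists (Num.bound (c / e)); apply: archi_boundP; rewrite divr_ge0 // ltW.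
exists n; rewrite ltr_pdivrMr ?ltr0n // mulrC -ltr_pdivrMr //.
by apply: lt_trans hn _; rewrite ltr_nat.
Qed.

(** Completeness with an explicit rate; all limits below are taken through
    this lemma. *)
Lemma cauchy_rate (u : nat -> H) (c : R) : 0 <= c ->
  (forall n m, (n <= m)%N -> normR (u m - u n) <= c / n.+1%:R) ->
  exists l, forall n, normR (l - u n) <= c / n.+1%:R.
Proof.
move=> c0 hu.
have cu : cvg (u @ \oo).
  apply/cauchy_cvgP; apply: cauchy_exP => e e0.
  have [e1 ee] : 0 < complex.Re e /\ e = (complex.Re e)%:C.
    by move: e0; case: e => p q; rewrite ltcE /= => /andP[/eqP -> ?].
  have [n hn] := small_rate c0 e1.
  exists (u n); exists n => // m /= nm.
  rewrite -ball_normE /= ee normRE ltcR normR_distC.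
  by apply: le_lt_trans hn; exact: hu.
exists (lim (u @ \oo)) => n; apply/ler_addgt0Pr => e e0.
have := cu; move/cvgrPdist_lt => /(_ e%:C); rewrite ltcR => /(_ e0)[m _ hm].
have := hm (maxn m n) (leq_maxl _ _); rewrite normRE ltcR => h1.
apply: le_trans (normRB3 (u (maxn m n)) _ _) _.
by rewrite [leRHS]addrC; apply: lerD; [exact: ltW | apply: hu; exact: leq_maxr].
Qed.

(** Closedness is expressed by approximation in norm, which for a normed space
    is topological closedness. *)
Definition closed_subspace (M : set H) :=
  [/\ M 0, forall a x y, M x -> M y -> M (a *: x + y)
    & forall x, (forall e : R, 0 < e -> exists2 y, M y & normR (x - y) < e) -> M x].

Lemma csub0 M : closed_subspace M -> M 0. Proof. by case. Qed.
Lemma csubZ M : closed_subspace M -> forall a x, M x -> M (a *: x).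
Proof. by move=> [M0 ML _] a x Mx; rewrite -[a *: x]addr0; exact: ML. Qed.
Lemma csubD M : closed_subspace M -> forall x y, M x -> M y -> M (x + y).
Proof. by move=> [M0 ML _] x y Mx My; rewrite -[x]scale1r; exact: ML. Qed.
Lemma csubN M : closed_subspace M -> forall x, M x -> M (- x).
Proof. by move=> cM x Mx; rewrite -scaleN1r; exact: csubZ. Qed.
Lemma csubB M : closed_subspace M -> forall x y, M x -> M y -> M (x - y).
Proof. by move=> cM x y Mx My; apply: (csubD cM) => //; exact: (csubN cM). Qed.

Lemma csub_lim M (u : nat -> H) l (c : R) : closed_subspace M -> 0 <= c ->
  (forall n, M (u n)) -> (forall n, normR (l - u n) <= c / n.+1%:R) -> M l.
Proof.
move=> [_ _ cM] c0 Mu hl; apply: cM => e e0.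
have [n hn] := small_rate c0 e0; exists (u n) => //.
exact: le_lt_trans (hl n) hn.
Qed.

Lemma le_rate (a b c : R) : 0 <= c -> (forall n, a <= b + c / n.+1%:R) -> a <= b.
Proof.
move=> c0 h; apply/ler_addgt0Pr => e e0; have [n hn] := small_rate c0 e0.
by apply: le_trans (h n) _; rewrite lerD2l ltW.
Qed.

(** A minimising sequence for the distance to M is Cauchy by the parallelogram
    law; each of its terms is already orthogonal to M up to an error controlled
    by its excess over the minimum, so the limit is exactly orthogonal. *)
Lemma projection_theorem M x : closed_subspace M ->
  exists2 m, M m & forall y, M y -> ip (x - m) y = 0.
Proof.
move=> cM; pose D : set R := [set normR (x - m) ^+ 2 | m in M].
have lD : has_lbound D by exists 0 => _ [m _ <-]; exact: sqr_ge0.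
have hD : has_inf D by split => //; exists (normR (x - 0) ^+ 2); exists 0 => //; exact: csub0.
pose d := inf D.
have dle m : M m -> d <= normR (x - m) ^+ 2.
  by move=> Mm; apply: ge_inf => //; exists m.
(* squared rates are used because the distance is minimised in square *)
pose s n : R := n.+1%:R^-1.
have s0 n : 0 < s n by rewrite invr_gt0 ltr0n.
have /choice[u hu] n : exists m, M m /\ normR (x - m) ^+ 2 < d + s n ^+ 2.
  have [|_ [m Mm <-] h] := @inf_adherent _ D (s n ^+ 2) _ hD; last by exists m.
  by rewrite exprn_gt0.
have Mu n : M (u n) by case: (hu n).
have ule n : normR (x - u n) ^+ 2 < d + s n ^+ 2 by case: (hu n).
have cu n m : (n <= m)%N -> normR (u m - u n) <= 2 / n.+1%:R.
  move=> nm; rewrite -/(s n).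
  rewrite -(@ler_pXn2r _ 2) ?nnegrE ?normR_ge0 ?mulr_ge0 ?(ltW (s0 _)) //.
  have := parallelogram (x - u n) (x - u m).
  have -> : x - u n - (x - u m) = u m - u n by vec ip.
  have := dle _ (csubZ cM (2^-1) (csubD cM (Mu n) (Mu m))).
  have -> : x - u n + (x - u m) = 2%:C *: (x - 2^-1 *: (u n + u m)).
    rewrite rmorph_nat scalerBr scalerA mulfV ?pnatr_eq0 // scale1r.
    by vec ip.
  rewrite normRZ // exprMn => h1 h2.
  have h3 : s m ^+ 2 <= s n ^+ 2.
    by rewrite ler_pXn2r ?nnegrE ?(ltW (s0 _)) // /s lef_pV2 ?posrE ?ltr0n // ler_nat ltnS.
  have := ule n; have := ule m; rewrite exprMn.
  by move: h1 h2 h3; lra.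
have [l hl] := cauchy_rate (ler0n _ 2) cu.
exists l; first exact: csub_lim hl.
apply: ipR_ip_eq0 => [|y My]; first exact: csubZ.
have key n : `|ipR (x - u n) y| <= s n * normR y.
  rewrite -(@ler_pXn2r _ 2) ?nnegrE ?mulr_ge0 ?normR_ge0 ?(ltW (s0 _)) //.
  rewrite real_normK ?num_real // exprMn; apply: quadratic_ge0 => [|t]; first exact: sqr_ge0.
  have := dle _ (csubD cM (Mu n) (csubZ cM t%:C My)).
  have -> : x - (u n + t%:C *: y) = (x - u n) - t%:C *: y by vec ip.
  have := ule n; rewrite -!ipRxx !(ipRE, =^~ ipRxx) (ipRC y x) (ipRC y (u n)) => h1 h2.
  by lra.
apply/eqP; rewrite -normr_le0.
apply: (@le_rate _ _ (3 * normR y)) => [|n]; first by rewrite mulr_ge0 ?normR_ge0.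
rewrite add0r -/(s n).
have -> : x - l = (x - u n) + - (l - u n) by vec ip.
rewrite ipRDl; apply: le_trans (ler_normD _ _) _.
have h1 := ipR_CauchySchwarz (- (l - u n)) y; rewrite normRN in h1.
have h2 := key n; have h3 := hl n.
have h4 : normR (l - u n) * normR y <= 2 * s n * normR y.
  by rewrite ler_wpM2r ?normR_ge0.
by lra.
Qed.

End RealGeometry.

(** * Bounded operators and positivity *)

Section Operators.
Local Open Scope complex_scope.
Context (R : realType) (H : completeNormedModType R[i]).
Context (ip : {dot H for @Num.conj R[i]}) (hH : hilbert_norm ip).
Implicit Types (x y z : H) (a : R[i]) (t k : R) (M N : set H) (f g : H -> H).

Lemma normRZc a x : normR (a *: x) = complex.Re `|a| * normR x.
Proof. by rewrite /normR normrZ normRE; case: `|a| => u v /=; ring. Qed.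

Lemma abs_Re_ge0 a : 0 <= complex.Re `|a|.
Proof. by have := normr_ge0 a; case: `|a| => u v; rewrite lecE /= => /andP[]. Qed.

Lemma ip_ipR x y : ip x y = ipR ip x y +i* ipR ip x ((0 +i* 1) *: y).
Proof. by rewrite /ipR ipZr; case: (ip x y) => u v /=; congr (_ +i* _); ring. Qed.

(** Repackaging a linear function gives access to the rewriting theory of
    linear maps. *)
Lemma linear_pack f : linear f -> exists g : {linear H -> H}, f = g.
Proof.
move=> lf; pose m := GRing.isLinear.Build _ _ _ _ f lf.
pose g : {linear H -> H} := HB.pack f m; by exists g.
Qed.

(** The bound in [bounded_op] is an arbitrary element of R[i]; it may be
    replaced by its absolute value, a nonnegative real. *)
Lemma bounded_opP M N f : bounded_op M N f <->
  [/\ forall x, M x -> N (f x),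
      forall a x y, M x -> M y -> f (a *: x + y) = a *: f x + f y
    & exists2 k, 0 <= k & forall x, M x -> normR (f x) <= k * normR x].
Proof.
split=> [[fMN lf [k hk]]|[fMN lf [k k0 hk]]]; split => //.
  exists (complex.Re `|k|) => [|x Mx]; first exact: abs_Re_ge0.
  rewrite -normRZc normR_le normrZ; have h := hk _ Mx.
  have h0 := le_trans (normr_ge0 _) h.
  by apply: le_trans h _; rewrite -(ger0_norm h0) normrM normr_id.
by exists k%:C => x Mx; rewrite !normRE -rmorphM /= lecR; exact: hk.
Qed.

Definition bounded_linear f := bounded_op setT setT f.

Lemma bounded_linearP f : bounded_linear f <->
  linear f /\ exists2 k, 0 <= k & forall x, normR (f x) <= k * normR x.
Proof.
split=> [/bounded_opP[_ lf [k k0 hk]]|[lf [k k0 hk]]].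
  by split => [a x y|]; [exact: lf|exists k => // x; exact: hk].
by apply/bounded_opP; split => [//|a x y _ _|]; [exact: lf|exists k].
Qed.

Lemma bounded_linear_comp f g : bounded_linear f -> bounded_linear g -> bounded_linear (f \o g).
Proof.
move=> /bounded_linearP[lf [k k0 hk]] /bounded_linearP[lg [l l0 hl]]; apply/bounded_linearP; split=> [a x y|].
  by rewrite /= lg lf.
exists (k * l) => [|x /=]; first exact: mulr_ge0.
by apply: le_trans (hk _) _; rewrite -mulrA ler_wpM2l.
Qed.

Lemma bounded_linearD f g : bounded_linear f -> bounded_linear g -> bounded_linear (f + g).
Proof.
move=> /bounded_linearP[lf [k k0 hk]] /bounded_linearP[lg [l l0 hl]]; apply/bounded_linearP; split=> [a x y|].
  by rewrite /= !fctE lf lg; vec ip.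
exists (k + l) => [|x /=]; first exact: addr_ge0.
by rewrite fctE mulrDl; apply: le_trans (normRD _ _) _; exact: lerD.
Qed.

Lemma bounded_linearN f : bounded_linear f -> bounded_linear (- f).
Proof.
move=> /bounded_linearP[lf [k k0 hk]]; apply/bounded_linearP; split=> [a x y|].
  by rewrite /= !fctE lf; vec ip.
by exists k => // x; rewrite fctE normRN.
Qed.

Lemma bounded_linear_id : bounded_linear idfun.
Proof. by apply/bounded_linearP; split => //; exists 1 => // x; rewrite mul1r. Qed.

Lemma bounded_linearB f g : bounded_linear f -> bounded_linear g -> bounded_linear (f - g).
Proof. by move=> hf hg; apply: bounded_linearD => //; exact: bounded_linearN. Qed.

Lemma closed_equalizer f g : bounded_linear f -> bounded_linear g -> closed_subspace [set x | f x = g x].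
Proof.
move=> bf bg; have /bounded_linearP[lh [k k0 hk]] := bounded_linearB bf bg.
have [h hE] := linear_pack lh.
have E x : (f x = g x) <-> h x = 0.
  by rewrite -hE fctE; split => [->|/eqP]; rewrite ?subrr // subr_eq0 => /eqP.
split => [|a x y /E hx /E hy|x hx]; apply/E; first exact: linear0.
  by rewrite linearP hx hy scaler0 addr0.
apply: normR_eq0; apply/eqP; rewrite eq_le normR_ge0 andbT.
apply/ler_addgt0Pr => e e0; rewrite add0r.
have k1 : 0 < k + 1 by apply: ltr_wpDl.
have [|y /E hy hxy] := hx (e / (k + 1)); first by rewrite divr_gt0.
rewrite -[h x]subr0 -hy -linearB -hE; apply: le_trans (hk _) _.
have := ltW hxy; rewrite ler_pdivlMr // => h1; have := normR_ge0 (x - y); nra.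
Qed.

(** Density criterion: by the projection theorem a closed subspace with trivial
    orthogonal complement in N fills N. *)
Lemma sub_closed_of_ortho M N : closed_subspace M ->
  (forall x y, N x -> N y -> N (x - y)) -> M `<=` N ->
  (forall z, N z -> (forall y, M y -> ip z y = 0) -> z = 0) -> N `<=` M.
Proof.
move=> cM NB MN h x Nx; have [m Mm hm] := projection_theorem hH x cM.
have /eqP : x - m = 0 by apply: h => //; apply: NB => //; exact: MN.
by rewrite subr_eq0 => /eqP ->.
Qed.

(** For a self-adjoint B the ranges of B and of the inclusion of ker B together
    span a dense subspace, since a vector orthogonal to the range of B lies in
    its kernel. *)
Lemma bounded_linear_ext (B : {linear H -> H}) f g :
  (forall x y, ip (B x) y = ip x (B y)) -> bounded_linear f -> bounded_linear g ->
  (forall x, f (B x) = g (B x)) -> (forall x, B x = 0 -> f x = g x) -> f = g.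
Proof.
move=> sB bf bg h1 h2; apply/funext => x.
apply: (@sub_closed_of_ortho [set x | f x = g x] setT) => //.
  exact: closed_equalizer.
move=> z _ hz; have Bz : B z = 0.
  by apply: (ip_eq0 (ip := ip)); rewrite sB; apply: hz => /=.
by apply: (ip_eq0 (ip := ip)); apply: hz; exact: h2.
Qed.

Section OnSubspace.
Context (M N : set H) (cM : closed_subspace M) (f : H -> H).
Context (bf : bounded_op M N f).

Lemma opD x y : M x -> M y -> f (x + y) = f x + f y.
Proof. by case: bf => _ lf _ Mx My; rewrite -{1}[x]scale1r lf // scale1r. Qed.
Lemma op0 : f 0 = 0.
Proof.
have M0 := csub0 cM; have := opD M0 M0; rewrite addr0 => /eqP.
by rewrite -subr_eq subrr => /eqP.
Qed.
Lemma opZ a x : M x -> f (a *: x) = a *: f x.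
Proof.
move=> Mx; case: (bf) => _ lf _.
by rewrite -[a *: x]addr0 lf // ?op0 ?addr0 //; exact: csub0.
Qed.
Lemma opN x : M x -> f (- x) = - f x.
Proof. by move=> Mx; rewrite -scaleN1r opZ // scaleN1r. Qed.
Lemma opB x y : M x -> M y -> f (x - y) = f x - f y.
Proof. by move=> Mx My; rewrite opD ?opN //; exact: csubN. Qed.
Lemma op_in x : M x -> N (f x). Proof. by case: bf => h _ _; exact: h. Qed.
End OnSubspace.

Section Positive.
Context (M : set H) (cM : closed_subspace M).

(** Polarisation: the sesquilinear form ip (A x) y - ip x (A y) vanishes on the
    diagonal, hence everywhere because the scalars are complex. *)
Lemma positive_self_adjoint A x y : bounded_op M M A -> positive_op ip M A ->
  M x -> M y -> ip (A x) y = ip x (A y).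
Proof.
move=> bA pA Mx My.
have diag z : M z -> ip (A z) z = ip z (A z).
  by move=> Mz; rewrite [RHS]ipC geC0_conj //; exact: pA.
pose i : R[i] := 0 +i* 1.
have ii : i * i = -1 by rewrite /i; congr (_ +i* _) => /=; ring.
have ci : Num.conj i = - i by rewrite /i; congr (_ +i* _) => /=; ring.
have iy : M (i *: y) by exact: csubZ.
have h1 := diag _ (csubD cM Mx My); have h2 := diag _ (csubD cM Mx iy).
have dx := diag _ Mx; have dy := diag _ My; have diy := diag _ iy.
move: h1 h2 diy; rewrite !(opD bA) ?(opZ cM bA) // !ipE ci dx dy => h1 h2 _.
have i0 : i != 0 by apply/eqP => i0; move: ii; rewrite i0 mul0r => /eqP; rewrite eq_sym oppr_eq0 oner_eq0.
pose s := ip (A x) y - ip x (A y); pose s' := ip (A y) x - ip y (A x).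
have e1 : s + s' = 0.
  rewrite /s /s'; transitivity (ip x (A x) + ip (A x) y + (ip (A y) x + ip y (A y)) -
    (ip x (A x) + ip x (A y) + (ip y (A x) + ip y (A y)))); first by ring.
  by rewrite -h1; ring.
have e2 : i * (s' - s) = 0.
  rewrite /s /s'; transitivity (ip x (A x) + (- i) * ip (A x) y + (i * ip (A y) x + i * (- i * ip y (A y))) -
    (ip x (A x) + (- i) * ip x (A y) + (i * ip y (A x) + i * (- i * ip y (A y))))); first by ring.
  by rewrite -h2; ring.
move/eqP: e2; rewrite mulf_eq0 (negPf i0) /= subr_eq0 => /eqP e2.
move: e1; rewrite e2 -mulr2n => /eqP; rewrite mulrn_eq0 /= subr_eq0.
by move/eqP.
Qed.

(** Positivity at x - t A x for every real t is a quadratic inequality in t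
    whose constant term is 0; its discriminant bounds the linear coefficient. *)
Lemma positive_ker A x : bounded_op M M A -> positive_op ip M A ->
  M x -> ip (A x) x = 0 -> A x = 0.
Proof.
move=> bA pA Mx h; have MA := op_in bA.
apply: (ip_eq0 (ip := ip)); rewrite (ipxx hH).
suff h1 : (normR (A x) ^+ 2) ^+ 2 <= 0 * ipR ip (A (A x)) (A x).
  suff -> : normR (A x) ^+ 2 = 0 by [].
  by apply/eqP; rewrite -sqrf_eq0 eq_le sqr_ge0 andbT; rewrite mul0r in h1.
have Re_ge0 z : M z -> 0 <= ipR ip (A z) z.
  by move=> /pA; rewrite /ipR; case: (ip _ _) => u v; rewrite lecE => /andP[].
apply: quadratic_ge0 => [|t]; first by apply: Re_ge0; exact: MA.
have := Re_ge0 _ (csubB cM Mx (csubZ cM t%:C (MA _ Mx))).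
rewrite (opB cM bA) ?(opZ cM bA) //; try exact: MA; try by apply: (csubZ cM); exact: MA.
rewrite !ipRE -!(ipRxx hH).
have -> : ipR ip (A (A x)) x = ipR ip (A x) (A x).
  by rewrite /ipR (positive_self_adjoint bA pA) //; exact: MA.
have -> : ipR ip (A x) x = 0 by rewrite /ipR h.
by move=> h2; lra.
Qed.

(** Put y := (B - C) x.  Then (B + C) y = (B^2 - C^2) x = 0 because B and C
    commute, so positivity gives B y = C y = 0, and |y|^2 = ip ((B - C) y) x = 0. *)
Lemma positive_sqrt_unique B C x : bounded_op M M B -> positive_op ip M B ->
  bounded_op M M C -> positive_op ip M C ->
  (forall z, M z -> B (B z) = C (C z)) -> (forall z, M z -> B (C z) = C (B z)) ->
  M x -> B x = C x.
Proof.
move=> bB pB bC pC BC com Mx.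
have Bx := op_in bB Mx; have Cx := op_in bC Mx.
pose y := B x - C x; have My : M y by exact: csubB.
have h : ip (B y) y + ip (C y) y = 0.
  rewrite -ipDl /y (opB cM bB) // (opB cM bC) // BC // com //.
  have -> : C (C x) - C (B x) + (C (B x) - C (C x)) = 0 by vec ip.
  by rewrite ip0l.
have By0 : ip (B y) y = 0.
  apply/eqP; rewrite eq_le pB // andbT; move/eqP: h; rewrite addr_eq0 => /eqP ->.
  by rewrite oppr_le0 pC.
have Cy0 : ip (C y) y = 0 by move: h; rewrite By0 add0r.
have By := positive_ker bB pB My By0; have Cy := positive_ker bC pC My Cy0.
apply/eqP; rewrite -subr_eq0 -/y; apply/eqP; apply: (ip_eq0 (ip := ip)).
rewrite {2}/y ipDr ipNr -(positive_self_adjoint bB pB) //.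
by rewrite -(positive_self_adjoint bC pC) // By Cy !ip0l subrr.
Qed.

End Positive.
End Operators.

(** * Existence of positive square roots *)

Section SquareRoot.
Local Open Scope complex_scope.
Context (R : realType) (H : completeNormedModType R[i]).
Context (ip : {dot H for @Num.conj R[i]}) (hH : hilbert_norm ip).
Implicit Types (x y z : H) (a : R[i]) (t k : R) (M N : set H).

Lemma lim_unique (u v : H) (c : R) : 0 <= c ->
  (forall n : nat, normR (u - v) <= c / n.+1%:R) -> u = v.
Proof.
move=> c0 h; apply/eqP; rewrite -subr_eq0; apply/eqP; apply: normR_eq0.
apply/eqP; rewrite eq_le normR_ge0 andbT; apply: (le_rate c0) => n.
by rewrite add0r.
Qed.

(** The iteration y -> (1 + y^2) / 2 increases to its fixed point 1; it is the
    case A = 0 of [sqrt_iter] and dominates the operator iteration. *)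
Fixpoint sqrt_scalar (n : nat) : R :=
  if n is m.+1 then (1 + sqrt_scalar m ^+ 2) / 2 else 0.

Lemma sqrt_scalar_bounds n :
  [/\ 0 <= sqrt_scalar n, sqrt_scalar n <= 1 & sqrt_scalar n <= sqrt_scalar n.+1].
Proof.
elim: n => [|n [h0 h1 h2]] /=; first by split; nra.
by move: h0 h1 h2 => /=; move: (sqrt_scalar n) => y *; split; nra.
Qed.

(** With d := 1 - y one step is d -> d - d^2 / 2, which is increasing on [0, 1]
    and sends 2 / q below 2 / (q + 1) for q >= 2. *)
Lemma sqrt_scalar_rate n : 1 - sqrt_scalar n <= 2 / n.+2%:R.
Proof.
elim: n => [|n IH] /=; first by rewrite subr0 mulfV ?pnatr_eq0.
have [h0 h1 _] := sqrt_scalar_bounds n.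
move: h0 h1 IH; move: (sqrt_scalar n) => y h0 h1.
rewrite !ler_pdivlMr ?ltr0n // -[n.+3]addn1 natrD.
have : 2 <= n.+2%:R :> R by rewrite ler_nat.
move: (n.+2%:R) => q h2 h3.
have h4 : 1 - (1 + y ^+ 2) / 2 = (1 - y) - (1 - y) ^+ 2 / 2 by field.
rewrite h4; move: h3; set d := 1 - y => h3.
have d0 : 0 <= d by rewrite /d; lra.
have d1 : d <= 1 by rewrite /d; lra.
nra.
Qed.

Context (A : {linear H -> H}) (pA : positive_op ip setT A).
Context (cA : forall x, normR (A x) <= normR x).

(** Iterates for the equation 2 L = (1 - A) + L^2, whose solution makes
    (1 - L)^2 = A. *)
Fixpoint sqrt_iter (n : nat) x : H :=
  if n is m.+1 then (2^-1)%:C *: ((x - A x) + sqrt_iter m (sqrt_iter m x)) else 0.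

Lemma Re_ge0 (a : R[i]) : 0 <= a -> 0 <= complex.Re a.
Proof. by case: a => u v; rewrite lecE => /andP[]. Qed.

(** Positivity of A at x - A x together with |A (A x)| <= |A x| gives
    |A x|^2 <= ip (A x) x, which is more than |x - A x|^2 <= |x|^2 requires. *)
Lemma one_sub_contraction x : normR (x - A x) <= normR x.
Proof.
have bA : bounded_linear A by apply/bounded_linearP; split; [exact: linearP|exists 1 => // y; rewrite mul1r].
have cT : closed_subspace (@setT H) by [].
have sA y z : ip (A y) z = ip y (A z) by apply: (positive_self_adjoint cT).
rewrite -(@ler_pXn2r _ 2) ?nnegrE ?normR_ge0 // -!(ipRxx hH).
have := Re_ge0 (@pA (x - A x) I); rewrite -/(ipR _ _ _) linearB /= !ipRE.
have -> : ipR ip (A (A x)) x = ipR ip (A x) (A x) by rewrite /ipR sA.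
have h1 := ipR_CauchySchwarz hH (A (A x)) (A x).
have h2 := cA (A x); have := normR_ge0 (A x).
rewrite (ipRC ip x (A x)); move: h1 h2; rewrite (ipRxx hH).
set p := ipR _ (A (A x)) _; set q := normR (A x); set q' := normR (A (A x)) => h1 h2 h3 h4.
have h5 : p <= q ^+ 2.
  apply: le_trans (ler_norm _) _; apply: le_trans h1 _.
  by rewrite expr2 ler_wpM2r.
by have := sqr_ge0 q; lra.
Qed.

Lemma sqrt_iter_linear n : linear (sqrt_iter n).
Proof.
elim: n => [|n IH] a x y /=; first by rewrite scaler0 addr0.
by rewrite !IH; vec ip.
Qed.

Lemma sqrt_iter_le n x : normR (sqrt_iter n x) <= sqrt_scalar n * normR x.
Proof.
elim: n x => [|n IH] x /=; first by rewrite normR0 mul0r.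
rewrite normRZ ?invr_ge0 //; have [h0 _ _] := sqrt_scalar_bounds n.
have := normRD (x - A x) (sqrt_iter n (sqrt_iter n x)).
have := one_sub_contraction x; have := IH (sqrt_iter n x).
have := ler_wpM2l h0 (IH x); lra.
Qed.

(** Successive differences factor as
    Y_(n+1)^2 - Y_n^2 = Y_(n+1) (Y_(n+1) - Y_n) + (Y_(n+1) - Y_n) Y_n,
    so they are bounded by the corresponding differences of scalars. *)
Lemma sqrt_iter_step n x :
  normR (sqrt_iter n.+1 x - sqrt_iter n x) <= (sqrt_scalar n.+1 - sqrt_scalar n) * normR x.
Proof.
elim: n x => [|n IH] x.
  rewrite /= !subr0 !addr0 normRZ ?invr_ge0 // expr0n /= addr0.
  by have := one_sub_contraction x; lra.
have [h0 _ _] := sqrt_scalar_bounds n.+1; have [_ _ h1] := sqrt_scalar_bounds n.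
have step z := sqrt_iter_le n.+1 z.
have Ey : sqrt_scalar n.+1 = (1 + sqrt_scalar n ^+ 2) / 2 by [].
have EY : sqrt_iter n.+1 x = (2^-1)%:C *: (x - A x + sqrt_iter n (sqrt_iter n x)) by [].
have -> : sqrt_iter n.+2 x = (2^-1)%:C *: (x - A x + sqrt_iter n.+1 (sqrt_iter n.+1 x)) by [].
have -> : sqrt_scalar n.+2 = (1 + sqrt_scalar n.+1 ^+ 2) / 2 by [].
have [Y ZE] := linear_pack (sqrt_iter_linear n.+1); have [Y' ZE'] := linear_pack (sqrt_iter_linear n).
move: ZE' ZE Ey EY IH h0 h1 step (@sqrt_iter_le n).
move: (sqrt_iter n.+1) (sqrt_iter n) (sqrt_scalar n.+1) (sqrt_scalar n) => _ _ y y' -> -> Ey EY IH h0 h1 step step'.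
have -> : (2^-1)%:C *: (x - A x + Y (Y x)) - Y x =
    (2^-1)%:C *: (Y (Y x - Y' x) + (Y (Y' x) - Y' (Y' x))).
  by rewrite [X in _ - X]EY; vec ip.
have -> : (1 + y ^+ 2) / 2 - y = 2^-1 * (y * (y - y') + (y - y') * y').
  by rewrite [X in _ - X = _]Ey; field.
rewrite normRZ ?invr_ge0 // -mulrA ler_wpM2l ?invr_ge0 //.
apply: le_trans (normRD _ _) _; rewrite mulrDl -!mulrA.
apply: lerD.
  by apply: le_trans (step _) _; rewrite ler_wpM2l //; exact: IH.
apply: le_trans (IH _) _; rewrite ler_wpM2l ?subr_ge0 //; exact: step'.
Qed.

Lemma sqrt_iter_cauchy n m x : (n <= m)%N ->
  normR (sqrt_iter m x - sqrt_iter n x) <= (2 * normR x) / n.+1%:R.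
Proof.
move=> nm.
suff : normR (sqrt_iter m x - sqrt_iter n x) <= (sqrt_scalar m - sqrt_scalar n) * normR x.
  move=> h; apply: le_trans h _; rewrite mulrAC ler_wpM2r ?normR_ge0 //.
  have [_ h1 _] := sqrt_scalar_bounds m.
  apply: le_trans (le_trans _ (sqrt_scalar_rate n)) _; first by rewrite lerD2r.
  by rewrite ler_wpM2l // lef_pV2 ?posrE ?ltr0n // ler_nat.
rewrite -(subnKC nm); elim: (m - n)%N => [|k IH].
  by rewrite addn0 !subrr normR0 mul0r.
rewrite addnS; apply: le_trans (normRB3 (sqrt_iter (n + k) x) _ _) _.
by have := sqrt_iter_step (n + k) x; lra.
Qed.

(** B is 1 - L for the strong limit L of the iterates.  The last clause holds
    because every iterate is a polynomial in A; it is stated relative to an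
    invariant subspace M so that operators defined on M alone can be compared
    with B there. *)
Lemma positive_sqrt_exists : exists B : {linear H -> H},
  [/\ positive_op ip setT B, bounded_linear B, forall x, B (B x) = A x
    & forall M, closed_subspace M -> (forall x, M x -> M (A x)) ->
      (forall x, M x -> M (B x)) /\
      forall Z, bounded_op M M Z -> (forall x, M x -> Z (A x) = A (Z x)) ->
        forall x, M x -> Z (B x) = B (Z x)].
Proof.
have /choice[L hL] x : exists l, forall n, normR (l - sqrt_iter n x) <= (2 * normR x) / n.+1%:R.
  apply: cauchy_rate => [|n m nm]; first by rewrite mulr_ge0 ?normR_ge0.
  exact: sqrt_iter_cauchy.
have n0 x := normR_ge0 x.
have lL : linear L.
  move=> a x y; apply: (@lim_unique _ _ (2 * normR (a *: x + y) + complex.Re `|a| * (2 * normR x) + 2 * normR y)) => [|n].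
    by rewrite !addr_ge0 ?mulr_ge0 ?abs_Re_ge0.
  have -> : L (a *: x + y) - (a *: L x + L y) = (L (a *: x + y) - sqrt_iter n (a *: x + y))
     + (- (a *: (L x - sqrt_iter n x)) - (L y - sqrt_iter n y)).
    by rewrite sqrt_iter_linear; vec ip.
  rewrite [leRHS]mulrDl [X in _ <= X + _]mulrDl -[leRHS]addrA; apply: le_trans (normRD _ _) _; apply: lerD; first exact: hL.
  apply: le_trans (normRD _ _) _; rewrite !normRN normRZc -!mulrA mulrA; apply: lerD => //.
    by rewrite -mulrA ler_wpM2l ?abs_Re_ge0 // mulrA; exact: hL.
  by rewrite mulrA; exact: hL.
have [L' LE] := linear_pack lL; rewrite {}LE in hL; clear L lL.
have Lc x : normR (L' x) <= normR x.
  apply: (@le_rate _ _ _ (2 * normR x)) => [|n]; first by rewrite mulr_ge0.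
  have -> : L' x = sqrt_iter n x + (L' x - sqrt_iter n x) by vec ip.
  apply: le_trans (normRD _ _) _; apply: lerD; last exact: hL.
  apply: le_trans (sqrt_iter_le _ _) _; rewrite -[leRHS]mul1r ler_wpM2r //.
  by case: (sqrt_scalar_bounds n).
have LL x : 2%:C *: L' x = (x - A x) + L' (L' x).
  apply: (@lim_unique _ _ (2 * (2 * normR x) + (2 * normR x) + 2 * normR (L' x))) => [|n].
    by rewrite !addr_ge0 ?mulr_ge0.
  have [Z ZE] := linear_pack (sqrt_iter_linear n).
  have -> : 2%:C *: L' x - (x - A x + L' (L' x)) =
     2%:C *: (L' x - sqrt_iter n.+1 x) + ( - sqrt_iter n (L' x - sqrt_iter n x) -
       (L' (L' x) - sqrt_iter n (L' x))).
    rewrite /= ZE [2%:C *: (_ - _)]scalerBr scalerA -rmorphM /= mulfV ?pnatr_eq0 // scale1r.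
    by vec ip.
  rewrite [leRHS]mulrDl [X in _ <= X + _]mulrDl -[leRHS]addrA; apply: le_trans (normRD _ _) _; apply: lerD.
    rewrite normRZ // -mulrA ler_wpM2l //; apply: le_trans (hL _ _) _.
    by rewrite ler_wpM2l ?mulr_ge0 // lef_pV2 ?posrE ?ltr0n // ler_nat.
  apply: le_trans (normRD _ _) _; rewrite !normRN; apply: lerD; last exact: hL.
  apply: le_trans (hL x n); apply: le_trans (sqrt_iter_le _ _) _.
  rewrite -[leRHS]mul1r ler_wpM2r //; by case: (sqrt_scalar_bounds n).
have sA y z : ip (A y) z = ip y (A z).
  have bA : bounded_linear A by apply/bounded_linearP; split; [exact: linearP|exists 1 => // w; rewrite mul1r].
  by apply: (@positive_self_adjoint _ _ ip setT).
have sY n x y : ip (sqrt_iter n x) y = ip x (sqrt_iter n y).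
  elim: n x y => [|n IH] x y /=; first by rewrite !ipE.
  by rewrite ipZl ipZr !ipDl !ipDr !IH !ipNl !ipNr sA; congr (_ * _); rewrite geC0_conj // lecR invr_ge0.
have srL x y : ipR ip (L' x) y = ipR ip x (L' y).
  apply/eqP; rewrite -subr_eq0 -normr_le0.
  apply: (@le_rate _ _ _ (4 * (normR x * normR y))) => [|n]; first by rewrite !mulr_ge0.
  have -> : ipR ip (L' x) y - ipR ip x (L' y) =
      ipR ip (L' x - sqrt_iter n x) y - ipR ip x (L' y - sqrt_iter n y).
    by rewrite !ipRE /ipR sY; ring.
  rewrite add0r; apply: le_trans (ler_normB _ _) _.
  have := ipR_CauchySchwarz hH (L' x - sqrt_iter n x) y.
  have := ipR_CauchySchwarz hH x (L' y - sqrt_iter n y).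
  have := ler_wpM2r (n0 y) (hL x n); have := ler_wpM2l (n0 x) (hL y n).
  by set s := n.+1%:R^-1; lra.
have sL x y : ip (L' x) y = ip x (L' y).
  by rewrite !ip_ipR !srL linearZ.
have lB : linear (fun x => x - L' x) by move=> a x y; vec ip.
have [B BE] := linear_pack lB.
have {}BE x : B x = x - L' x by rewrite -BE.
exists B; split.
- move=> x _; rewrite BE.
  have hr : ipR ip (x - L' x) x = normR x ^+ 2 - ipR ip (L' x) x by rewrite !ipRE (ipRxx hH).
  have hi : complex.Im (ip (x - L' x) x) = 0.
    have : Num.conj (ip (x - L' x) x) = ip (x - L' x) x by rewrite -ipC !ipE sL.
    by case: (ip _ _) => u v [] /eqP; rewrite eq_sym -addr_eq0 -mulr2n mulrn_eq0 /= => /eqP.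
  rewrite lecE /= hi eqxx /= -/(ipR ip (x - L' x) x) hr subr_ge0.
  apply: le_trans (ler_norm _) _; apply: le_trans (ipR_CauchySchwarz hH _ _) _.
  by rewrite expr2 ler_wpM2r.
- apply/bounded_linearP; split; first exact: linearP.
  exists 2 => // x; rewrite BE; apply: le_trans (normRD _ _) _; rewrite normRN.
  by have := Lc x; lra.
- move=> x; rewrite !BE linearB /=.
  have := LL x; rewrite rmorph_nat scaler_nat mulr2n => e.
  have -> : x - L' x - (L' x - L' (L' x)) = x + L' (L' x) - (L' x + L' x) by vec ip.
  by rewrite e; vec ip.
move=> M cM MA.
have MY n x : M x -> M (sqrt_iter n x).
  elim: n x => [|n IH] x Mx /=; first exact: csub0.
  apply: (csubZ cM); apply: (csubD cM); last by exact: (IH _ (IH _ Mx)).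
  by apply: (csubB cM) => //; exact: MA.
have ML x : M x -> M (L' x).
  move=> Mx; apply: (csub_lim cM) (hL x) => [|n]; first by rewrite mulr_ge0.
  exact: MY.
split=> [x Mx|Z bZ com x Mx]; first by rewrite BE; apply: (csubB cM) => //; exact: ML.
have MZ := op_in bZ.
have comY n z : M z -> Z (sqrt_iter n z) = sqrt_iter n (Z z).
  elim: n z => [|n IH] z Mz /=; first exact: (op0 cM bZ).
  have M1 : M (z - A z) by apply: (csubB cM) => //; exact: MA.
  have M2 : M (sqrt_iter n (sqrt_iter n z)) by apply: (MY); exact: MY.
  have M3 := csubD cM M1 M2; have M4 := MA _ Mz; have M5 := MY n _ Mz.
  by rewrite (opZ cM bZ) // (opD bZ) // (opB cM bZ) // com // !IH.
rewrite !BE (opB cM bZ) //; last exact: ML.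
congr (_ - _).
have /bounded_opP[_ _ [k k0 hk]] := bZ.
apply: (@lim_unique _ _ (k * (2 * normR x) + 2 * normR (Z x))) => [|n].
  by rewrite addr_ge0 ?mulr_ge0.
have -> : Z (L' x) - L' (Z x) = Z (L' x - sqrt_iter n x) - (L' (Z x) - sqrt_iter n (Z x)).
  by rewrite (opB cM bZ) ?comY //; [vec ip|exact: ML|exact: MY].
apply: le_trans (normRD _ _) _; rewrite normRN mulrDl; apply: lerD; last exact: hL.
have Md : M (L' x - sqrt_iter n x) by apply: (csubB cM); [exact: ML|exact: MY].
apply: le_trans (hk _ Md) _; rewrite -mulrA ler_wpM2l //; exact: hL.
Qed.

End SquareRoot.

(** * Extension of isometric relations to unitaries *)

Section IsometricExtension.
Local Open Scope complex_scope.
Context (R : realType) (H : completeNormedModType R[i]).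
Context (ip : {dot H for @Num.conj R[i]}) (hH : hilbert_norm ip).
Implicit Types (x y z : H) (a : R[i]) (t k : R) (M N : set H) (G : H -> H -> Prop).

(** A densely defined isometry given by its graph.  A relation rather than a
    function is convenient because the natural parametrisation of the domain
    need not be injective; single-valuedness follows from [isor_normR]. *)
Record isometric_relation M N G : Prop := IsometricRelation {
  isor_sub : forall x y, G x y -> M x /\ N y;
  isor_lin : forall a x y x' y', G x y -> G x' y' -> G (a *: x + x') (a *: y + y');
  isor_0 : G 0 0;
  isor_normR : forall x y, G x y -> normR x = normR y }.

Lemma isor_B M N G x y x' y' : isometric_relation M N G ->
  G x y -> G x' y' -> G (x - x') (y - y').
Proof.
move=> iG g g'; rewrite -scaleN1r -(scaleN1r y') [x + _]addrC [y + _]addrC.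
exact: (isor_lin iG).
Qed.

Definition relation_closure G x y := forall e : R, 0 < e ->
  exists x' y', [/\ G x' y', normR (x - x') < e & normR (y - y') < e].

Lemma isometric_relation_sym M N G :
  isometric_relation M N G -> isometric_relation N M (fun x y => G y x).
Proof.
move=> [h1 h2 h3 h4]; split => // [x y /h1[]|a x y x' y' g g'|x y /h4 ->] //.
exact: h2.
Qed.

Lemma relation_closure_sym G x y :
  relation_closure G x y -> relation_closure (fun x y => G y x) y x.
Proof. by move=> h e /h[x' [y' [? ? ?]]]; exists y', x'. Qed.

Lemma isometric_relation_closure M N G : closed_subspace M -> closed_subspace N ->
  isometric_relation M N G -> isometric_relation M N (relation_closure G).
Proof.
move=> [_ _ cM] [_ _ cN] [Gsub Glin G0 Gnr]; split.
- move=> x y h; split; [apply: cM|apply: cN] => e /h[x' [y' [g ? ?]]].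
    by exists x' => //; case: (Gsub _ _ g).
  by exists y' => //; case: (Gsub _ _ g).
- move=> a x y x' y' h h' e e0.
  pose k := complex.Re `|a| + 1.
  have k0 : 0 < k by apply: ltr_wpDl => //; exact: abs_Re_ge0.
  have d0 : 0 < e / 2 / k by rewrite !divr_gt0.
  have [u [v [g h1 h2]]] := h _ d0; have e20 : 0 < e / 2 by rewrite divr_gt0.
  have [u' [v' [g' h1' h2']]] := h' _ e20.
  have key z z' w w' : normR (z - z') < e / 2 / k -> normR (w - w') < e / 2 ->
      normR (a *: z + w - (a *: z' + w')) < e.
    rewrite ltr_pdivlMr // => hz hw.
    have -> : a *: z + w - (a *: z' + w') = a *: (z - z') + (w - w') by vec ip.
    apply: le_lt_trans (normRD _ _) _; rewrite normRZc.
    by move: hz; rewrite /k; have := normR_ge0 (z - z'); lra.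
  by exists (a *: u + u'), (a *: v + v'); split; [exact: Glin|exact: key|exact: key].
- by move=> e e0; exists 0, 0; rewrite subrr normR0.
- have key (G' : H -> H -> Prop) x y : (forall x y, G' x y -> normR x = normR y) ->
     relation_closure G' x y -> normR x <= normR y.
    move=> h g; apply/ler_addgt0Pr => e e0; have e20 : 0 < e / 2 by rewrite divr_gt0.
    have [u [v [/h guv h1 h2]]] := g _ e20.
    have := normRD (x - u) u; rewrite subrK.
    have := normRD (v - y) y; rewrite subrK normR_distC; lra.
  move=> x y g; apply/eqP; rewrite eq_le (key G) //=.
  by apply: key (relation_closure_sym g) => u v /Gnr ->.
Qed.

(** The domain of the closed relation is closed: along a convergent sequence of
    arguments the images are Cauchy by isometry.  Density then makes it all
    of M. *)
Lemma isometric_relation_closure_total M N G :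
  closed_subspace M -> closed_subspace N -> isometric_relation M N G ->
  (forall z, M z -> (forall x y, G x y -> ip z x = 0) -> z = 0) ->
  forall x, M x -> exists y, relation_closure G x y.
Proof.
move=> cM cN iG dense.
have iC := isometric_relation_closure cM cN iG; have [Csub Clin C0 Cnr] := iC.
pose D : set H := [set x | exists y, relation_closure G x y].
have cD : closed_subspace D.
  split; first by exists 0.
    by move=> a x y [x' hx] [y' hy]; exists (a *: x' + y'); exact: Clin.
  move=> x hx.
  have hn (n : nat) : exists p : H * H, relation_closure G p.1 p.2 /\ normR (x - p.1) <= n.+1%:R^-1.
    have [|u [v g] h] := hx (n.+1%:R^-1); first by rewrite invr_gt0 ltr0n.
    by exists (u, v); split => //; exact: ltW.
  have /choice[w hw] := hn.
  have iB : forall n m, normR ((w m).2 - (w n).2) = normR ((w m).1 - (w n).1).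
    move=> n m; apply/esym/Cnr; apply: (isor_B iC); first by case: (hw m).
    by case: (hw n).
  have [|l hl] := @cauchy_rate _ _ (fun n => (w n).2) 2 (ler0n _ _).
    move=> n m nm; rewrite iB; apply: le_trans (normRB3 x _ _) _.
    have [_ h1] := hw n; have [_ h2] := hw m; rewrite normR_distC.
    have : m.+1%:R^-1 <= n.+1%:R^-1 :> R by rewrite lef_pV2 ?posrE ?ltr0n // ler_nat.
    move: h1 h2; set s := n.+1%:R^-1; set s2 := m.+1%:R^-1; lra.
  exists l => e e0; have e20 : 0 < e / 2 by rewrite divr_gt0.
  have [n hn'] := small_rate (ler0n R 2) e20.
  have n0 : 0 < n.+1%:R^-1 :> R by rewrite invr_gt0 ltr0n.
  have [g h1] := hw n; have [u [v [guv h2 h3]]] := g _ e20.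
  exists u, v; split => //.
    apply: le_lt_trans (normRB3 (w n).1 _ _) _; move: h1 hn' n0.
    by set s := n.+1%:R^-1; lra.
  apply: le_lt_trans (normRB3 (w n).2 _ _) _; have := hl n; move: hn'; set s := n.+1%:R^-1; lra.
move=> x Mx; apply: (sub_closed_of_ortho hH cD (N := M)) => //.
- by move=> *; exact: csubB.
- by move=> u [v /Csub[]].
move=> z Mz hz; apply: dense => // u v g; apply: hz.
exists v => e e0; exists u, v; by rewrite !subrr normR0.
Qed.

Lemma is_adj_op_eq M N A B C : closed_subspace M -> is_adj_op ip M N A B ->
  is_adj_op ip M N A C -> forall y, N y -> B y = C y.
Proof.
move=> cM [B1 B2] [C1 C2] y Ny; apply/eqP; rewrite -subr_eq0; apply/eqP.
apply: (ip_eq0 (ip := ip)).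
have Md : M (B y - C y) by apply: (csubB cM); [exact: B1|exact: C1].
by rewrite {2}(_ : B y - C y = B y - C y) // ipDr ipNr -B2 // -C2 // subrr.
Qed.

Lemma adj_opP M N A B : is_adj_op ip M N A B -> is_adj_op ip M N A (adj_op ip M N A).
Proof. by move=> h; rewrite /adj_op; case: xgetP => [_ -> //|/(_ B)]. Qed.

Lemma adj_op_eq M N A B : closed_subspace M -> is_adj_op ip M N A B ->
  forall y, N y -> adj_op ip M N A y = B y.
Proof. by move=> cM h y; exact: (is_adj_op_eq cM (adj_opP h) h). Qed.

Lemma unitary_opI M N U V : closed_subspace M -> bounded_op M N U -> is_adj_op ip M N U V ->
  (forall x, M x -> V (U x) = x) -> (forall y, N y -> U (V y) = y) -> unitary_op ip M N U.
Proof.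
move=> cM bU aUV h1 h2; split => // [x Mx|y Ny]; rewrite (adj_op_eq cM aUV) ?h1 ?h2 //.
exact: (op_in bU).
Qed.

(** If the adjoint were only the default value 0, the unitarity equations would
    force M and N to be trivial, and 0 would be a genuine adjoint. *)
Lemma unitary_adj M N U : closed_subspace M -> closed_subspace N -> unitary_op ip M N U ->
  is_adj_op ip M N U (adj_op ip M N U).
Proof.
move=> cM cN [bU h1 h2].
rewrite /adj_op; case: xgetP => [_ -> //|no].
have E y : N y -> adj_op ip M N U y = 0.
  by move=> Ny; rewrite /adj_op; case: xgetP => [B _ /no|].
have M0 x : M x -> x = 0.
  by move=> Mx; rewrite -(h1 _ Mx) E //; exact: (op_in bU).
have N0 y : N y -> y = 0.
  by move=> Ny; rewrite -(h2 _ Ny) E // (op0 cM bU).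
by case: (no 0); split=> [y _|x y /M0 -> /N0 ->]; [exact: csub0|rewrite !ipE].
Qed.

(** The closure of the relation is total in both directions, since the
    hypotheses are symmetric in the two variables; the two resulting functions
    are mutually inverse and adjoint to each other by polarisation. *)
Lemma isometric_extension M N G :
  closed_subspace M -> closed_subspace N -> isometric_relation M N G ->
  (forall z, M z -> (forall x y, G x y -> ip z x = 0) -> z = 0) ->
  (forall z, N z -> (forall x y, G x y -> ip z y = 0) -> z = 0) ->
  exists2 U, unitary_op ip M N U & forall x y, G x y -> U x = y.
Proof.
move=> cM cN iG dM dN.
have iC := isometric_relation_closure cM cN iG; have [Csub Clin C0 Cnr] := iC.
have tM := isometric_relation_closure_total cM cN iG dM.
have tN y : N y -> exists x, relation_closure G x y.
  have dN' z : N z -> (forall y x, G x y -> ip z y = 0) -> z = 0.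
    by move=> Nz hz; apply: dN => // u v; exact: hz.
  move=> /(isometric_relation_closure_total cN cM (isometric_relation_sym iG) dN').
  by move=> [x /relation_closure_sym ?]; exists x.
pose U x := xget 0 (relation_closure G x).
pose V y := xget 0 (fun x => relation_closure G x y).
have UC x : M x -> relation_closure G x (U x).
  by move=> /tM[y hy]; rewrite /U; case: xgetP => [? -> //|/(_ y)].
have VC y : N y -> relation_closure G (V y) y.
  by move=> /tN[x hx]; rewrite /V; case: xgetP => [? -> //|/(_ x)].
have CB x y x' y' : relation_closure G x y -> relation_closure G x' y' ->
    relation_closure G (x - x') (y - y').
  exact: (isor_B iC).
have fn x y y' : relation_closure G x y -> relation_closure G x y' -> y = y'.
  move=> g g'; apply/eqP; rewrite -subr_eq0; apply/eqP; apply: normR_eq0.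
  by rewrite -(Cnr _ _ (CB _ _ _ _ g g')) subrr normR0.
have inj x x' y : relation_closure G x y -> relation_closure G x' y -> x = x'.
  move=> g g'; apply/eqP; rewrite -subr_eq0; apply/eqP; apply: normR_eq0.
  by rewrite (Cnr _ _ (CB _ _ _ _ g g')) subrr normR0.
have MU x : M x -> N (U x) by move=> /UC/Csub[].
have NV y : N y -> M (V y) by move=> /VC/Csub[].
have lU a x y : M x -> M y -> U (a *: x + y) = a *: U x + U y.
  move=> Mx My; apply: (fn (a *: x + y)); last by apply: Clin; exact: UC.
  by apply: UC; apply: (csubD cM) => //; exact: (csubZ cM).
have bU : bounded_op M N U.
  apply/bounded_opP; split => //; exists 1 => // x Mx.
  by rewrite mul1r (Cnr _ _ (UC _ Mx)).
have VU x : M x -> V (U x) = x by move=> Mx; apply: inj (VC _ (MU _ Mx)) (UC _ Mx).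
have UV y : N y -> U (V y) = y by move=> Ny; apply: fn (UC _ (NV _ Ny)) (VC _ Ny).
have ipR_U x y : M x -> M y -> ipR ip (U x) (U y) = ipR ip x y.
  move=> Mx My; have := Cnr _ _ (UC _ (csubD cM Mx My)).
  rewrite (opD bU) // => /(congr1 (fun t => t ^+ 2)); rewrite -!(ipRxx hH) !ipRE.
  rewrite (ipRC ip y x) (ipRC ip (U y) (U x)) !(ipRxx hH).
  by rewrite (Cnr _ _ (UC _ Mx)) (Cnr _ _ (UC _ My)) => h; lra.
exists U; last first.
  move=> x y g; have gC : relation_closure G x y.
    by move=> e e0; exists x, y; rewrite !subrr normR0.
  by have [Mx _] := Csub _ _ gC; exact: fn (UC _ Mx) gC.
apply: (unitary_opI (V := V)) => //; split=> // x y Mx Ny.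
have MV := NV _ Ny; have MiV := csubZ cM (0 +i* 1) MV.
by rewrite -{1}(UV _ Ny) !ip_ipR -(opZ cM bU) // !ipR_U.
Qed.

End IsometricExtension.

(** * Unitary operators and their adjoints *)

Section UnitaryFacts.
Local Open Scope complex_scope.
Context (R : realType) (H : completeNormedModType R[i]).
Context (ip : {dot H for @Num.conj R[i]}) (hH : hilbert_norm ip).
Implicit Types (x y z : H) (M N : set H).

Lemma half_addvv x : (2^-1 : R[i]) *: (x + x) = x.
Proof.
rewrite scalerDr -scalerDl; have -> : 2^-1 + 2^-1 = 1 :> R[i] by field.
by rewrite scale1r.
Qed.

Lemma closed_subspace_setT : closed_subspace (@setT H). Proof. by []. Qed.

Context (M N : set H) (cM : closed_subspace M) (cN : closed_subspace N).
Context (U : H -> H) (uU : unitary_op ip M N U).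
Local Notation V := (adj_op ip M N U).

Lemma unitary_bounded : bounded_op M N U. Proof. by case: uU. Qed.

Lemma unitaryK x : M x -> V (U x) = x. Proof. by case: uU => _ + _; apply. Qed.

Lemma unitaryVK y : N y -> U (V y) = y. Proof. by case: uU => _ _; apply. Qed.

Lemma unitary_ip x y : M x -> N y -> ip (U x) y = ip x (V y).
Proof. by case: (unitary_adj cM cN uU) => _; apply. Qed.

Lemma unitary_adj_in y : N y -> M (V y).
Proof. by case: (unitary_adj cM cN uU) => + _; apply. Qed.

Lemma unitary_normR x : M x -> normR (U x) = normR x.
Proof.
move=> Mx; have NU := op_in unitary_bounded Mx.
apply/eqP; rewrite -(@eqrXn2 _ 2) ?normR_ge0 //; apply/eqP.
by rewrite -!(ipRxx hH) /ipR unitary_ip // unitaryK.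
Qed.

Lemma unitary_adj_normR y : N y -> normR (V y) = normR y.
Proof.
by move=> Ny; rewrite -{2}(unitaryVK Ny) unitary_normR //; exact: unitary_adj_in.
Qed.

Lemma unitary_adj_bounded : bounded_op N M V.
Proof.
apply/bounded_opP; split; first exact: unitary_adj_in.
  move=> a x y Nx Ny.
  have Vx := unitary_adj_in Nx; have Vy := unitary_adj_in Ny.
  have Ml : M (a *: V x + V y) by case: cM => _ + _; apply.
  by rewrite -(unitaryK Ml) (opD unitary_bounded) ?(opZ cM unitary_bounded) ?unitaryVK //; exact: csubZ.
by exists 1 => // y Ny; rewrite mul1r unitary_adj_normR.
Qed.

End UnitaryFacts.

(** Decides linear identities between words in two idempotents. *)
Ltac opvec ip P Q PP QQ :=
  rewrite ?(linearD P, linearN P, linearD Q, linearN Q) ?(PP, QQ);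
  apply: (@ip_ext _ _ ip) => ?; rewrite !(ipDl, ipNl, ip0l); ring.

(** * The algebra of two projections *)

Section TwoProjections.
Local Open Scope complex_scope.
Context (R : realType) (H : completeNormedModType R[i]).
Context (ip : {dot H for @Num.conj R[i]}) (hH : hilbert_norm ip).
Implicit Types (x y z : H) (M N : set H).

(** If the adjoint of P were only the default value 0, then P = 0, which is
    self-adjoint. *)
Lemma orthogonal_projection_linear (P : H -> H) : orthogonal_projection ip P ->
  exists P' : {linear H -> H}, [/\ P = P', forall x, P' (P' x) = P' x
    & forall x y, ip (P' x) y = ip x (P' y)].
Proof.
move=> [/bounded_linearP[lP _] aP iP]; have [P' PE] := linear_pack lP; exists P'.
split => // [x|x y]; rewrite -PE; first by rewrite {3}iP.
have : is_adj_op ip setT setT P P.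
  rewrite {2}aP /adj_op; case: xgetP => [B _ //|no].
  have P0 : P = 0 by rewrite aP /adj_op; case: xgetP => // B _ /no.
  by case: (no 0); split => // u v _ _; rewrite P0 !ipE.
by case=> _; apply.
Qed.

Lemma projection_contraction (P : {linear H -> H}) : (forall x, P (P x) = P x) ->
  (forall x y, ip (P x) y = ip x (P y)) -> forall x, normR (P x) <= normR x.
Proof.
move=> PP sP x; rewrite -(@ler_pXn2r _ 2) ?nnegrE ?normR_ge0 // -!(ipRxx hH).
have := sqr_ge0 (normR (x - P x)); rewrite -(ipRxx hH) !ipRE.
have e : ipR ip (P x) (P x) = ipR ip (P x) x by rewrite /ipR sP PP -sP.
by rewrite (ipRC ip x) e => h; lra.
Qed.

(** T = QP + (1-Q)(1-P); its adjoint is obtained by exchanging P and Q. *)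
Definition transfer (P Q : H -> H) x : H := Q (P x) + (x - P x - Q (x - P x)).
(** A = 1 - (P-Q)^2, expanded. *)
Definition cos_square (P Q : H -> H) x : H := x - P x - Q x + P (Q x) + Q (P x).

Context (P Q : {linear H -> H}).
Context (PP : forall x, P (P x) = P x) (sP : forall x y, ip (P x) y = ip x (P y)).
Context (QQ : forall x, Q (Q x) = Q x) (sQ : forall x y, ip (Q x) y = ip x (Q y)).

Local Notation T := (transfer P Q).
Local Notation T' := (transfer Q P).
Local Notation A := (cos_square P Q).

Lemma range_projection x : range P x <-> P x = x.
Proof. by split=> [[y _ <-]|<-]; [rewrite PP|exists x]. Qed.

Lemma transfer_linear : linear T.
Proof.
by move=> a x y; rewrite /transfer ?(linearD P, linearN P, linearZ_LR P, linearD Q, linearN Q, linearZ_LR Q) /=;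
  apply: (@ip_ext _ _ ip) => ?; rewrite !(ipDl, ipNl, ipZl); ring.
Qed.
Lemma cos_square_linear : linear A.
Proof.
by move=> a x y; rewrite /cos_square ?(linearD P, linearN P, linearZ_LR P, linearD Q, linearN Q, linearZ_LR Q) /=;
  apply: (@ip_ext _ _ ip) => ?; rewrite !(ipDl, ipNl, ipZl); ring.
Qed.

Lemma transfer_adjK x : T' (T x) = A x.
Proof. by rewrite /transfer /cos_square; opvec ip P Q PP QQ. Qed.
Lemma transferK_adj x : T (T' x) = A x.
Proof. by rewrite /transfer /cos_square; opvec ip P Q PP QQ. Qed.
Lemma transfer_add x : T x + T' x = A x + A x.
Proof. by rewrite /transfer /cos_square; opvec ip P Q PP QQ. Qed.

Lemma transfer_adj x y : ip (T x) y = ip x (T' y).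
Proof.
by rewrite /transfer ?(linearD P, linearN P, linearD Q, linearN Q) !ipE !sQ !sP; ring.
Qed.

Lemma transfer_normR_sqr x : normR (T x) ^+ 2 =
  normR (Q (P x)) ^+ 2 + normR (x - P x - Q (x - P x)) ^+ 2.
Proof.
rewrite -!(ipRxx hH) /transfer.
have h y z : ipR ip (Q y) (z - Q z) = 0 by rewrite /ipR sQ linearB /= QQ subrr ip0r.
have : ipR ip (Q (P x)) (x - P x - Q (x - P x)) = 0 by exact: h.
move: (Q (P x)) (x - P x - Q (x - P x)) => u v uv.
by rewrite !(ipRDl, ipRDr) (ipRC ip v u) uv; ring.
Qed.

Lemma projection_pythagoras x : normR (P x) ^+ 2 + normR (x - P x) ^+ 2 = normR x ^+ 2.
Proof.
rewrite -!(ipRxx hH) !ipRE (ipRC ip x (P x)).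
have -> : ipR ip (P x) (P x) = ipR ip (P x) x by rewrite /ipR sP PP -sP.
by ring.
Qed.

(** The images under P and 1-P are orthogonal, and so are those under Q and
    1-Q; T maps the first pair to the second without increasing norms. *)
Lemma transfer_contraction x : normR (T x) <= normR x.
Proof.
rewrite -(@ler_pXn2r _ 2) ?nnegrE ?normR_ge0 // transfer_normR_sqr -(projection_pythagoras x).
have sub y : normR (y - Q y) <= normR y.
  rewrite -(@ler_pXn2r _ 2) ?nnegrE ?normR_ge0 // -!(ipRxx hH) !ipRE (ipRC ip y (Q y)).
  have -> : ipR ip (Q y) (Q y) = ipR ip (Q y) y by rewrite /ipR sQ QQ -sQ.
  have : 0 <= ipR ip (Q y) y.
    by have := sqr_ge0 (normR (Q y)); rewrite -(ipRxx hH) /ipR sQ QQ -sQ.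
  by move=> h; lra.
apply: lerD; rewrite ler_pXn2r ?nnegrE ?normR_ge0 //.
exact: (projection_contraction QQ sQ).
Qed.

Lemma transfer_ker x : T x = 0 -> Q (P x) = 0 /\ Q (x - P x) = x - P x.
Proof.
move=> h; have := transfer_normR_sqr x; rewrite h normR0 expr0n /= => /esym/eqP.
rewrite paddr_eq0 ?sqr_ge0 // !sqrf_eq0 => /andP[/eqP/normR_eq0 -> /eqP/normR_eq0/eqP].
by rewrite subr_eq0 => /eqP <-.
Qed.

End TwoProjections.

(** * The cosine operator and direct rotations *)

Section AbsoluteValue.
Local Open Scope complex_scope.
Context (R : realType) (H : completeNormedModType R[i]).
Context (ip : {dot H for @Num.conj R[i]}) (hH : hilbert_norm ip).
Implicit Types (x y z : H) (M N : set H).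
Context (P Q : {linear H -> H}).
Context (PP : forall x, P (P x) = P x) (sP : forall x y, ip (P x) y = ip x (P y)).
Context (QQ : forall x, Q (Q x) = Q x) (sQ : forall x y, ip (Q x) y = ip x (Q y)).
Local Notation T := (transfer P Q).
Local Notation T' := (transfer Q P).
Local Notation A := (cos_square P Q).

(** The conclusion of [positive_sqrt_exists]: a positive square root of F that
    lies in the bicommutant of F on every closed invariant subspace. *)
Definition commutant_sqrt (F : H -> H) (B : {linear H -> H}) :=
  [/\ positive_op ip setT B, bounded_linear B, forall x, B (B x) = F x
    & forall M, closed_subspace M -> (forall x, M x -> M (F x)) ->
      (forall x, M x -> M (B x)) /\
      forall Z, bounded_op M M Z -> (forall x, M x -> Z (F x) = F (Z x)) ->
        forall x, M x -> Z (B x) = B (Z x)].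

Lemma ip_ge0 x : 0 <= ip x x. Proof. exact: dnorm_ge0. Qed.

Lemma cos_square_positive : positive_op ip setT A.
Proof.
move=> x _; rewrite -(transfer_adjK ip PP QQ) (transfer_adj sQ sP); exact: ip_ge0.
Qed.

Lemma cos_square_contraction x : normR (A x) <= normR x.
Proof.
rewrite -(transfer_adjK ip PP QQ).
apply: le_trans (transfer_contraction hH QQ sQ PP sP _) _.
exact: transfer_contraction.
Qed.

Lemma cos_exists : exists B, commutant_sqrt A B.
Proof.
have [A' AE] := linear_pack (cos_square_linear ip P Q).
rewrite AE; apply: positive_sqrt_exists => // [|x]; rewrite -AE.
  exact: cos_square_positive.
exact: cos_square_contraction.
Qed.

Context (B : {linear H -> H}) (hB : commutant_sqrt A B).

Lemma cos_self_adjoint x y : ip (B x) y = ip x (B y).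
Proof.
case: hB => pB bB _ _.
exact: (positive_self_adjoint (@closed_subspace_setT _ _) bB pB).
Qed.

Lemma cos_sqr x : B (B x) = A x. Proof. by case: hB. Qed.

Lemma cos_bounded : bounded_linear B. Proof. by case: hB. Qed.

Lemma cos_commute Z : bounded_linear Z -> (forall x, Z (A x) = A (Z x)) ->
  forall x, Z (B x) = B (Z x).
Proof.
move=> bZ com x; case: hB => _ _ _ /(_ setT (@closed_subspace_setT _ _) (fun _ _ => I)).
by case=> _ /(_ _ bZ (fun x _ => com x) x I).
Qed.

Lemma projection_bounded (E : {linear H -> H}) : (forall x, E (E x) = E x) ->
  (forall x y, ip (E x) y = ip x (E y)) -> bounded_linear E.
Proof.
move=> EE sE; apply/bounded_linearP; split; first exact: linearP.
by exists 1 => // x; rewrite mul1r; exact: (projection_contraction hH EE sE).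
Qed.

Lemma cos_commuteP x : P (B x) = B (P x).
Proof.
apply: cos_commute => [|z]; first exact: projection_bounded.
by rewrite /cos_square; opvec ip P Q PP QQ.
Qed.

Lemma cos_commuteQ x : Q (B x) = B (Q x).
Proof.
apply: cos_commute => [|z]; first exact: projection_bounded.
by rewrite /cos_square; opvec ip P Q PP QQ.
Qed.

Lemma cos_commuteT x : T (B x) = B (T x).
Proof.
by rewrite /transfer !(linearD, linearN) /= !(cos_commuteP, cos_commuteQ).
Qed.

Lemma cos_kerP u : B u = 0 -> [/\ Q (P u) = 0, Q (u - P u) = u - P u & T u = 0].
Proof.
move=> h; have Au : A u = 0 by rewrite -cos_sqr h linear0.
have Tu : T u = 0.
  by apply: (ip_eq0 (ip := ip)); rewrite (transfer_adj sP sQ) (transfer_adjK ip PP QQ) Au ip0r.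
by have [] := transfer_ker hH QQ sQ Tu.
Qed.

Lemma cos_ker_eq u : Q (P u) = 0 -> Q (u - P u) = u - P u -> B u = 0.
Proof.
move=> h1 h2; have Tu : T u = 0 by rewrite /transfer h1 h2; vec ip.
have T'0 : T' 0 = 0 by rewrite /transfer; vec ip.
by apply: (ip_eq0 (ip := ip)); rewrite cos_self_adjoint cos_sqr -(transfer_adjK ip PP QQ) Tu T'0 ip0r.
Qed.

Lemma transfer'_ker u : B u = 0 -> T' u = 0.
Proof.
case/cos_kerP => h1 h2 _.
have e : Q u = u - P u by rewrite -h2 linearB /= h1 subr0.
by rewrite /transfer e; opvec ip P Q PP QQ.
Qed.

(** |T x|^2 = ip (T* T x) x = ip (B^2 x) x = |B x|^2: B is the absolute value
    of T. *)
Lemma cos_normR x : normR (T x) = normR (B x).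
Proof.
apply/eqP; rewrite -(@eqrXn2 _ 2) ?normR_ge0 //; apply/eqP.
by rewrite -!(ipRxx hH) /ipR (transfer_adj sP sQ) (transfer_adjK ip PP QQ) cos_self_adjoint cos_sqr.
Qed.

Section FromUnitary.
Context (S : H -> H) (uS : unitary_op ip setT setT S).
Context (SB : forall x, S (B x) = T x).
Context (SS : forall u, B u = 0 -> S (S u) = - u).
Context (SK : forall u, B u = 0 -> B (S u) = 0).
Context (SPQ : forall u, B u = 0 -> S (P u) = Q (S u)).

(** By density, S B = T and the behaviour on ker B determine everything.  First
    S commutes with B; then S* B = T*, so (S + S* ) B = T + T* = 2 B^2 and hence
    S + S* = 2 B, which is Re S = B >= 0.  Multiplying by S gives
    S^2 = 2 S B - 1 = 2 T - 1. *)
Lemma direct_rotation_of : direct_rotation ip P Q S.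
Proof.
have cT := @closed_subspace_setT _ H.
have bS := unitary_bounded uS; have bV := unitary_adj_bounded hH cT cT uS.
have bB := cos_bounded; have lS := linear_pack (proj1 (proj1 (bounded_linearP S) bS)).
have [S' SE] := lS; have [V VE] := linear_pack (proj1 (proj1 (bounded_linearP _) bV)).
have VS x : V (S x) = x by rewrite -VE; exact: (unitaryK uS I).
have SV x : S (V x) = x by rewrite -VE; exact: (unitaryVK uS I).
have aS x y : ip (S x) y = ip x (V y) by rewrite -VE; exact: (unitary_ip cT cT uS I I).
have bV' : bounded_linear V by rewrite -VE.
have ext := bounded_linear_ext hH cos_self_adjoint.
have comSB x : S (B x) = B (S x).
  have -> : S (B x) = (S \o B) x by [].
  rewrite (ext (S \o B) (B \o S)) //=; [exact: bounded_linear_comp|exact: bounded_linear_comp| |].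
    by move=> z; rewrite SB SB cos_commuteT.
  by move=> u Bu; rewrite Bu SE linear0 -SE SK.
have comVB x : V (B x) = B (V x).
  by rewrite -{1}(SV x) -comSB VS.
have BV x : V (B x) = T' x.
  apply: (ip_ext (ip := ip)) => z; rewrite comVB cos_self_adjoint.
  by rewrite [LHS]ipC -aS SB (transfer_adj sP sQ) -ipC.
have SVB x : S x + V x = B x + B x.
  have -> : S x + V x = (S + (V : H -> H)) x by [].
  have b1 : bounded_linear (S + (V : H -> H)) by apply: (bounded_linearD ip).
  have b2 : bounded_linear ((B : H -> H) + (B : H -> H)) by apply: (bounded_linearD ip).
  rewrite (ext _ _ b1 b2) //.
    by move=> z; rewrite !fctE SB BV (transfer_add ip) cos_sqr.
  move=> u Bu; rewrite !fctE Bu addr0.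
  by have := congr1 V (SS Bu); rewrite VS linearN /= => ->; rewrite addNr.
split; [exact: uS| | |].
- apply/funext => x /=.
  have -> : S (P x) = (S \o P) x by [].
  have -> : Q (S x) = (Q \o S) x by [].
  congr (_ x); apply: ext.
  + by apply: bounded_linear_comp => //; exact: projection_bounded.
  + by apply: bounded_linear_comp => //; exact: projection_bounded.
  + by move=> z /=; rewrite cos_commuteP !SB /transfer; opvec ip P Q PP QQ.
  + by move=> u /SPQ.
- apply/funext => x /=; rewrite !fctE.
  have -> : S x = B x + B x - V x by rewrite -SVB addrK.
  rewrite SE !(linearD, linearN) /= -SE SB SV /perp /transfer !fctE /=.
  by opvec ip P Q PP QQ.
- move=> x _; rewrite /re_op !fctE VE SVB.
  rewrite half_addvv.
  by case: hB => + _ _ _; apply.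
Qed.

End FromUnitary.

Section FromDirectRotation.
Context (S : H -> H) (dS : direct_rotation ip P Q S).

(** 2 T - 1 = (1-2Q)(1-2P). *)
Lemma direct_rotation_sqr x : S (S x) = T x + T x - x.
Proof.
case: dS => _ _ /(congr1 (fun f => f x)) /= -> _.
by rewrite /perp /transfer !fctE /=; opvec ip P Q PP QQ.
Qed.

(** Re S is a positive operator with square (T + T* )/2 = A, so it equals B by
    uniqueness; then S B = (S^2 + 1)/2 = T. *)
Lemma direct_rotation_cos x : S (B x) = T x.
Proof.
have [uS SPQ _ pS] := dS.
have cT := @closed_subspace_setT _ H.
have bS := unitary_bounded uS; have bV := unitary_adj_bounded hH cT cT uS.
have [S' SE] := linear_pack (proj1 (proj1 (bounded_linearP S) bS)).
have [V VE] := linear_pack (proj1 (proj1 (bounded_linearP _) bV)).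
have VS z : V (S z) = z by rewrite -VE; exact: (unitaryK uS I).
have SV z : S (V z) = z by rewrite -VE; exact: (unitaryVK uS I).
have aS y z : ip (S y) z = ip y (V z) by rewrite -VE; exact: (unitary_ip cT cT uS I I).
have aV y z : ip (V y) z = ip y (S z) by rewrite ipC -aS -ipC.
have VV z : V (V z) = T' z + T' z - z.
  apply: (ip_ext (ip := ip)) => w; rewrite !aV direct_rotation_sqr.
  have := transfer_adj sQ sP z w; move: (T w) (T' z) => p q h.
  by rewrite !ipE h.
pose C := re_op ip S.
have CE z : C z = 2^-1 *: (S z + V z) by rewrite /C /re_op !fctE VE.
have lC : linear C by move=> a y z; rewrite !CE SE; vec ip.
have [C' C'E] := linear_pack lC.
have SC z : S (C z) = T z.
  rewrite CE SE linearZ linearD /= -SE SV direct_rotation_sqr subrK; exact: half_addvv.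
have VC z : V (C z) = T' z.
  rewrite CE linearZ linearD /= VS VV addrC subrK; exact: half_addvv.
have CC z : C (C z) = A z by rewrite CE SC VC (transfer_add ip) half_addvv.
have bC : bounded_linear C.
  have bV' : bounded_linear V by rewrite -VE.
  have b1 : bounded_linear (S + (V : H -> H)) by apply: (bounded_linearD ip).
  have /bounded_linearP[_ [k k0 hk]] := b1.
  apply/bounded_linearP; split => //; exists (2^-1 * k); first by rewrite mulr_ge0 ?invr_ge0.
  move=> z; rewrite CE.
  have -> : 2^-1 = (2^-1)%:C :> R[i] by rewrite fmorphV /= rmorph_nat.
  by rewrite normRZ ?invr_ge0 // -mulrA ler_wpM2l ?invr_ge0 //; exact: hk.
have pB : positive_op ip setT B by case: hB.
rewrite -SC; congr (S _).
apply: (positive_sqrt_unique hH cT cos_bounded pB bC pS) => // z _.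
  by rewrite cos_sqr CC.
by rewrite -cos_commute // => w; rewrite -!CC.
Qed.

Lemma direct_rotation_ker u : B u = 0 -> S (S u) = - u.
Proof. by case/cos_kerP=> _ _ Tu; rewrite direct_rotation_sqr Tu; vec ip. Qed.

End FromDirectRotation.
End AbsoluteValue.

(** * Direct rotations and unitaries from H3 onto H2 *)

Section Rotation.
Local Open Scope complex_scope.
Context (R : realType) (H : completeNormedModType R[i]).
Context (ip : {dot H for @Num.conj R[i]}) (hH : hilbert_norm ip).
Implicit Types (x y z : H) (M N : set H).
Context (P Q : {linear H -> H}).
Context (PP : forall x, P (P x) = P x) (sP : forall x y, ip (P x) y = ip x (P y)).
Context (QQ : forall x, Q (Q x) = Q x) (sQ : forall x y, ip (Q x) y = ip x (Q y)).
Local Notation T := (transfer P Q).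
Local Notation T' := (transfer Q P).
Local Notation A := (cos_square P Q).

Lemma in_H2 x : H2 P Q x <-> P x = x /\ Q x = 0.
Proof. 
split=> [[/(range_projection PP) Px Qx]|[Px Qx]]; split=> //.
exact/(range_projection PP).
Qed.

Lemma in_H3 x : H3 P Q x <-> P x = 0 /\ Q x = x.
Proof. 
split=> [[Px /(range_projection QQ) Qx]|[Px Qx]]; split=> //.
exact/(range_projection QQ).
Qed.

Lemma closed_subspaceI M N : closed_subspace M -> closed_subspace N ->
  closed_subspace (M `&` N).
Proof.
move=> [M0 ML cM] [N0 NL cN]; split=> // [a x y [Mx Nx] [My Ny]|x h].
  by split; [exact: ML|exact: NL].
by split; [apply: cM|apply: cN] => e /h[y [My Ny] ?]; exists y.
Qed.

Lemma closed_range (E : {linear H -> H}) : (forall x, E (E x) = E x) ->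
  (forall x y, ip (E x) y = ip x (E y)) -> closed_subspace (range E).
Proof.
move=> EE sE; have -> : range E = [set x | E x = idfun x].
  by apply/seteqP; split => x /= /(range_projection EE).
by apply: (closed_equalizer ip); [exact: projection_bounded|exact: bounded_linear_id].
Qed.

Lemma closed_ker (E : {linear H -> H}) : (forall x, E (E x) = E x) ->
  (forall x y, ip (E x) y = ip x (E y)) -> closed_subspace (op_ker E).
Proof.
move=> EE sE; have -> : op_ker E = [set x | E x = (idfun - idfun : H -> H) x].
  by apply/seteqP; split => x /=; rewrite /op_ker /= !fctE subrr.
apply: (closed_equalizer ip); first exact: projection_bounded.
by apply: (bounded_linearB ip); exact: bounded_linear_id.
Qed.

Lemma closed_H2 : closed_subspace (H2 P Q).
Proof. by apply: closed_subspaceI; [exact: closed_range|exact: closed_ker]. Qed.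

Lemma closed_H3 : closed_subspace (H3 P Q).
Proof. by apply: closed_subspaceI; [exact: closed_ker|exact: closed_range]. Qed.

Context (B : {linear H -> H}) (hB : commutant_sqrt ip A B).

Lemma cos_ker_H23 u : B u = 0 -> H2 P Q (P u) /\ H3 P Q (u - P u).
Proof.
move=> Bu; have [h1 h2 _] := cos_kerP hH PP sP QQ sQ hB Bu.
by split; [apply/in_H2|apply/in_H3; rewrite linearB /=]; rewrite PP ?subrr.
Qed.

Lemma H2_cos_ker u : H2 P Q u -> B u = 0.
Proof.
move=> /in_H2[Pu Qu]; apply: (cos_ker_eq PP QQ hB); first by rewrite Pu.
by rewrite Pu subrr linear0.
Qed.

Lemma H3_cos_ker u : H3 P Q u -> B u = 0.
Proof.
move=> /in_H3[Pu Qu]; apply: (cos_ker_eq PP QQ hB); first by rewrite Pu linear0.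
by rewrite Pu subr0.
Qed.

Section FromC.
Context (C : H -> H) (uC : unitary_op ip (H3 P Q) (H2 P Q) C).
Local Notation C' := (adj_op ip (H3 P Q) (H2 P Q) C).

(** The operator (0, C; -C*, 0) on H2 + H3; for u in that sum the components
    are P u and u - P u. *)
Definition quarter_turn u : H := C (u - P u) - C' (P u).
Local Notation J := quarter_turn.

Lemma quarter_turn_ker u : B u = 0 ->
  [/\ P (J u) = C (u - P u), J u - P (J u) = - C' (P u) & B (J u) = 0].
Proof.
case/cos_ker_H23 => h2 h3.
have c2 : H2 P Q (C (u - P u)) := op_in (unitary_bounded uC) h3.
have c3 : H3 P Q (C' (P u)) := unitary_adj_in closed_H3 closed_H2 uC h2.
have e : P (J u) = C (u - P u).
  rewrite /quarter_turn linearB /=; move/in_H2: c2 => [-> _].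
  by move/in_H3: c3 => [-> _]; rewrite subr0.
split => //; first by rewrite e /quarter_turn addrAC subrr add0r.
by rewrite /quarter_turn linearB /= H2_cos_ker // H3_cos_ker // subrr.
Qed.

Lemma quarter_turn_sqr u : B u = 0 -> J (J u) = - u.
Proof.
move=> Bu; have [h2 h3] := cos_ker_H23 Bu; have [e1 e2 _] := quarter_turn_ker Bu.
rewrite {1}/quarter_turn e2 e1 (unitaryK uC) // (opN closed_H3 (unitary_bounded uC)).
  by rewrite (unitaryVK uC) //; vec ip.
exact: (unitary_adj_in closed_H3 closed_H2 uC h2).
Qed.

Lemma quarter_turn_linear a u v : B u = 0 -> B v = 0 -> J (a *: u + v) = a *: J u + J v.
Proof.
move=> /cos_ker_H23[u2 u3] /cos_ker_H23[v2 v3].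
have bC := unitary_bounded uC; have bC' := unitary_adj_bounded hH closed_H3 closed_H2 uC.
rewrite /quarter_turn linearP.
have -> : a *: u + v - (a *: P u + P v) = a *: (u - P u) + (v - P v) by vec ip.
case: bC => _ -> // _; case: bC' => _ -> // _; by vec ip.
Qed.

Lemma quarter_turn_normR u : B u = 0 -> normR (J u) = normR u.
Proof.
move=> Bu; have [h2 h3] := cos_ker_H23 Bu; have [e1 e2 _] := quarter_turn_ker Bu.
apply/eqP; rewrite -(@eqrXn2 _ 2) ?normR_ge0 //; apply/eqP.
rewrite -(projection_pythagoras hH PP sP u) -(projection_pythagoras hH PP sP (J u)) e2 e1 normRN.
rewrite (unitary_normR hH closed_H3 closed_H2 uC) //.
by rewrite (unitary_adj_normR hH closed_H3 closed_H2 uC) // addrC.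
Qed.

(** S is the unitary extension of B v + u |-> T v + J u with B u = 0.  This
    relation is isometric because |T v| = |B v|, because J preserves norms, and
    because both sums are orthogonal. *)
Lemma rotation_exists : exists S : H -> H, [/\ direct_rotation ip P Q S,
  forall x, H3 P Q x -> S x = C x & forall x, H2 P Q x -> S x = - C' x].
Proof.
have cT := @closed_subspace_setT _ H.
have [sB BB] := (cos_self_adjoint hB, cos_sqr hB).
have lT := transfer_linear ip P Q.
have T0 : T 0 = 0 by rewrite /transfer !(linear0, subr0, addr0).
have J0 : J 0 = 0.
  rewrite /quarter_turn linear0 subr0 (op0 closed_H3 (unitary_bounded uC)).
  by rewrite (op0 closed_H2 (unitary_adj_bounded hH closed_H3 closed_H2 uC)) subr0.
pose G x y := exists v u, [/\ B u = 0, x = B v + u & y = T v + J u].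
have Ju_ortho v u : B u = 0 -> ip (T v) (J u) = 0.
  move=> Bu; have [_ _ BJ] := quarter_turn_ker Bu.
  by rewrite (transfer_adj sP sQ) (transfer'_ker hH PP sP QQ sQ hB BJ) ip0r.
have iG : isometric_relation setT setT G.
  split => //.
  - move=> a _ _ _ _ [v [u [Bu -> ->]]] [v' [u' [Bu' -> ->]]].
    exists (a *: v + v'), (a *: u + u'); split.
    + by rewrite linearP Bu Bu' scaler0 addr0.
    + by rewrite linearP; vec ip.
    + rewrite lT quarter_turn_linear //.
      by move: (T v) (T v') => p q; vec ip.
  - by exists 0, 0; rewrite linear0 T0 J0 !addr0.
  - move=> _ _ [v [u [Bu -> ->]]].
    apply/eqP; rewrite -(@eqrXn2 _ 2) ?normR_ge0 //; apply/eqP.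
    have h1 : ipR ip (B v) u = 0 by rewrite /ipR sB Bu ip0r.
    have h2 : ipR ip (T v) (J u) = 0 by rewrite /ipR Ju_ortho.
    have h3 := cos_normR hH PP sP QQ sQ hB v; have h4 := quarter_turn_normR Bu.
    have pyth p q : ipR ip p q = 0 -> normR (p + q) ^+ 2 = normR p ^+ 2 + normR q ^+ 2.
      by move=> h; rewrite -!(ipRxx hH) !ipRE (ipRC ip q p) h; ring.
    by rewrite (pyth _ _ h1) (pyth _ _ h2) h3 h4.
have [||S uS SG] := isometric_extension hH cT cT iG.
(* a vector orthogonal to the domain lies in ker B, hence in the domain *)
- move=> z _ hz; have Bz : B z = 0.
    apply: (ip_eq0 (ip := ip)); rewrite sB; apply: (hz _ (T (B z))).
    by exists (B z), 0; rewrite linear0 J0 !addr0.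
  apply: (ip_eq0 (ip := ip)); apply: (hz _ (J z)).
  by exists 0, z; rewrite linear0 T0 !add0r.
- move=> z _ hz.
  (* a vector z orthogonal to the range has T* z = 0, so A z = T T* z = 0 and z lies in ker B = J (ker B) *)
  have T'z : T' z = 0.
    apply: (ip_eq0 (ip := ip)); rewrite (transfer_adj sQ sP); apply: (hz (B (T' z))).
    by exists (T' z), 0; rewrite linear0 J0 !addr0.
  have Bz : B z = 0.
    by apply: (ip_eq0 (ip := ip)); rewrite sB BB -(transferK_adj ip PP QQ) T'z T0 ip0r.
  have [_ _ BJ] := quarter_turn_ker Bz.
  have JJ : J (- J z) = z.
    rewrite -scaleN1r -[_ *: J z]addr0 quarter_turn_linear ?linear0 //.
    by rewrite J0 addr0 quarter_turn_sqr // scaleN1r opprK.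
  apply: (ip_eq0 (ip := ip)); apply: (hz (- J z)).
  by exists 0, (- J z); rewrite JJ linear0 T0 !add0r linearN /= BJ oppr0.
have SB x : S (B x) = T x.
  by apply: SG; exists x, 0; rewrite linear0 J0 !addr0.
have SJ u : B u = 0 -> S u = J u.
  by move=> Bu; apply: SG; exists 0, u; rewrite linear0 T0 !add0r.
exists S; split.
- apply: (direct_rotation_of hH PP sP QQ sQ hB uS SB) => u Bu.
  + by rewrite SJ // SJ ?quarter_turn_sqr //; case: (quarter_turn_ker Bu).
  + by rewrite SJ //; case: (quarter_turn_ker Bu).
  + have [h2 h3] := cos_ker_H23 Bu.
    rewrite SJ ?H2_cos_ker // SJ // /quarter_turn PP subrr.
    rewrite (op0 closed_H3 (unitary_bounded uC)) linearB /= add0r.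
    have /in_H2[_ ->] := op_in (unitary_bounded uC) h3.
    by have /in_H3[_ ->] := unitary_adj_in closed_H3 closed_H2 uC h2; rewrite sub0r.
- move=> x h3; rewrite SJ ?H3_cos_ker // /quarter_turn; have /in_H3[-> _] := h3.
  by rewrite subr0 (op0 closed_H2 (unitary_adj_bounded hH closed_H3 closed_H2 uC)) subr0.
- move=> x h2; rewrite SJ ?H2_cos_ker // /quarter_turn; have /in_H2[-> _] := h2.
  by rewrite subrr (op0 closed_H3 (unitary_bounded uC)) sub0r.
Qed.

End FromC.

Section FromS.
Context (S : H -> H) (dS : direct_rotation ip P Q S).

Let uS : unitary_op ip setT setT S. Proof. by case: dS. Qed.
Let SPQ x : S (P x) = Q (S x).
Proof. by case: dS => _ /(congr1 (fun f => f x)). Qed.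
Let cT := @closed_subspace_setT _ H.
Let lS := opN cT (unitary_bounded uS).

Lemma direct_rotation_inj x y : S x = S y -> x = y.
Proof. by move=> e; rewrite -(unitaryK uS (x := x)) // e (unitaryK uS). Qed.

Lemma direct_rotation_ker_sqr u : B u = 0 -> S (S u) = - u.
Proof. exact: (direct_rotation_ker hH PP sP QQ sQ hB dS). Qed.

(** Injectivity reduces P (S x) = S x to Q (S (S x)) = S (S x), which holds since
    S (S x) = - x. *)
Lemma direct_rotation_H3 x : H3 P Q x -> H2 P Q (S x).
Proof.
move=> h3; have Bx := H3_cos_ker h3; have [Px Qx] := (in_H3 x).1 h3.
apply/in_H2; split.
  apply: direct_rotation_inj.
  by rewrite SPQ !direct_rotation_ker_sqr // linearN /= Qx.
by rewrite -SPQ Px (op0 cT (unitary_bounded uS)).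
Qed.

Lemma direct_rotation_H2 x : H2 P Q x -> H3 P Q (S x).
Proof.
move=> h2; have Bx := H2_cos_ker h2; have [Px Qx] := (in_H2 x).1 h2.
apply/in_H3; split; last by rewrite -SPQ Px.
apply: direct_rotation_inj; rewrite (op0 cT (unitary_bounded uS)).
by rewrite SPQ !direct_rotation_ker_sqr // linearN /= Qx oppr0.
Qed.

(** On H2 + H3 one has S^2 = -1, so the inverse of S there is -S. *)
Lemma direct_rotation_is_adj :
  is_adj_op ip (H3 P Q) (H2 P Q) S (fun x => - S x).
Proof.
split => [y h2|x y h3 h2]; first by apply: (csubN closed_H3); exact: direct_rotation_H2.
have e : y = S (- S y).
  by rewrite lS // direct_rotation_ker_sqr ?opprK //; exact: H2_cos_ker.
rewrite {1}e (unitary_ip cT cT uS) // (unitaryK uS) //.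
Qed.

Lemma direct_rotation_unitary : unitary_op ip (H3 P Q) (H2 P Q) S.
Proof.
apply: (unitary_opI closed_H3 _ direct_rotation_is_adj).
- have /bounded_opP[_ l [k k0 hk]] := unitary_bounded uS.
  apply/bounded_opP; split; first exact: direct_rotation_H3.
    by move=> a x y _ _; exact: l.
  by exists k => // x _; exact: hk.
- by move=> x h3; rewrite direct_rotation_ker_sqr ?opprK //; exact: H3_cos_ker.
- by move=> y h2; rewrite lS // direct_rotation_ker_sqr ?opprK //; exact: H2_cos_ker.
Qed.

Lemma direct_rotation_adj x : H2 P Q x ->
  adj_op ip (H3 P Q) (H2 P Q) S x = - S x.
Proof. exact: (adj_op_eq closed_H3 direct_rotation_is_adj). Qed.

End FromS.
End Rotation.

(** * Hilbert dimension and unitaries *)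

Section Dimension.
Local Open Scope complex_scope.
Context (R : realType) (H : completeNormedModType R[i]).
Context (ip : {dot H for @Num.conj R[i]}) (hH : hilbert_norm ip).
Implicit Types (x y z : H) (M N E F : set H).

Definition orthonormal_set E :=
  forall e f, E e -> E f -> ip e f = (e == f)%:R.

(** A maximal orthonormal subset of M, from Zorn's lemma: a nonzero vector
    orthogonal to it could be normalised and adjoined. *)
Lemma orthonormal_basis_exists M : closed_subspace M ->
  exists E, orthonormal_basis ip M E.
Proof.
move=> cM; pose good E := E `<=` M /\ orthonormal_set E.
have [F FG totF|E [[EM oE] maxE]] := @Zorn_bigcup _ good.
  split=> [x [X /FG[XM _] /XM] //|e f [X FX Xe] [Y FY Yf]].
  have [_ oX] := FG _ FX; have [_ oY] := FG _ FY.
  by have [/(_ _ Xe) ?|/(_ _ Yf) ?] := totF _ _ FX FY; [exact: oY|exact: oX].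
exists E; split=> // x Mx xE; apply/eqP; apply: contrapT => /negP x0.
have nx : normR x != 0 by apply: contra x0 => /eqP/normR_eq0 ->.
pose u := (normR x)^-1%:C *: x.
have uu : ip u u = 1.
  rewrite (ipxx hH) /u normRZ ?invr_ge0 ?normR_ge0 // mulVf // expr1n //.
have ue e : E e -> ip u e = 0 by move=> Ee; rewrite ipZl xE // mulr0.
apply: (maxE (E `|` [set u])); last split.
- split=> [e ?|/(_ u (or_intror erefl)) /ue]; first by left.
  by rewrite uu => /eqP; rewrite oner_eq0.
- by move=> _ [/EM //|->]; exact: csubZ.
- have neq e : E e -> (e == u) = false.
    by move=> Ee; apply/eqP => eu; have := ue _ Ee; rewrite eu uu => /eqP; rewrite oner_eq0.
  move=> e f [Ee|->] [Ef|->].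
  + exact: oE.
  + by rewrite neq // ip_sym0 // ue.
  + by rewrite eq_sym neq // ue.
  + by rewrite eqxx uu.
Qed.

Lemma unitary_eq_hdim M N U : closed_subspace M -> closed_subspace N ->
  unitary_op ip M N U -> eq_hdim ip M N.
Proof.
move=> cM cN uU; have [E [EM oE bE]] := orthonormal_basis_exists cM.
have injU : {in E &, injective U}.
  move=> e f /set_mem /EM Me /set_mem /EM Mf ef.
  by rewrite -(unitaryK uU Me) ef (unitaryK uU).
have ipU x y : M x -> M y -> ip (U x) (U y) = ip x y.
  move=> Mx My; rewrite (unitary_ip cM cN uU) ?(unitaryK uU) //.
  exact: op_in (unitary_bounded uU) _ My.
exists E, (U @` E); split => //; last by rewrite card_eq_sym; exact: inj_card_eq.
split.
- by move=> _ [e /EM Me <-]; exact: op_in (unitary_bounded uU) _ Me.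
- move=> _ _ [e Ee <-] [f Ef <-]; rewrite ipU ?oE //; try exact: EM.
  congr (nat_of_bool _)%:R; apply/eqP/eqP => [-> //|ef].
  by apply: injU; rewrite ?inE.
- move=> y Ny hy; rewrite -(unitaryVK uU Ny).
  rewrite (bE (adj_op ip M N U y)) ?(op0 cM (unitary_bounded uU)) //.
    exact: (unitary_adj_in cM cN uU Ny).
  move=> e Ee; apply: ip_sym0; rewrite -(unitary_ip cM cN uU) //; last exact: EM.
  by apply: ip_sym0; apply: hy; exists e.
Qed.

(** The graph of the linear extension of phi to the algebraic span of E. *)
Inductive span_relation E (phi : H -> H) : H -> H -> Prop :=
| span_relation0 : span_relation E phi 0 0
| span_relationD a e x y : E e -> span_relation E phi x y ->
    span_relation E phi (a *: e + x) (a *: phi e + y).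

Lemma eq_hdim_unitary M N : closed_subspace M -> closed_subspace N ->
  eq_hdim ip M N -> exists U, unitary_op ip M N U.
Proof.
move=> cM cN [E [F [[EM oE bE] [FN oF bF] /card_set_bijP[phi [phiF phiI phiS]]]]].
pose G := span_relation E phi.
have Gphi e : E e -> G e (phi e).
  move=> Ee; have := span_relationD 1 Ee (span_relation0 E phi).
  by rewrite !scale1r !addr0.
have ephi e f : E e -> E f -> (phi e == phi f) = (e == f).
  by move=> Ee Ef; apply/eqP/eqP => [|-> //]; apply: phiI; rewrite inE.
have pF e : E e -> F (phi e) by exact: phiF.
have Gip x y x' y' : G x y -> G x' y' -> ip x x' = ip y y'.
  move=> g; elim: g x' y' => [x' y' _|a e {}x {}y Ee g IH x' y' g'].
    by rewrite !ip0l.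
  rewrite !ipDl !ipZl (IH _ _ g'); congr (_ * _ + _).
  elim: g' => [|b f {}x' {}y' Ef g' IH']; first by rewrite !ip0r.
  by rewrite !ipDr !ipZr IH' oE // (oF (phi e) (phi f)) ?ephi //; exact: pF.
have iG : isometric_relation M N G.
  split.
  - move=> x y; elim=> [|a e {}x {}y Ee g [Mx Ny]]; first by split; exact: csub0.
    split; first by case: cM => _ + _; apply => //; exact: EM.
    by case: cN => _ + _; apply => //; apply: FN; exact: pF.
  - move=> a x y x' y' g g'; elim: g => [|b e {}x {}y Ee g IH].
      by rewrite !scaler0 !add0r.
    rewrite !scalerDr !scalerA -!addrA; exact: span_relationD.
  - exact: span_relation0.
  - move=> x y g; apply/eqP; rewrite -(@eqrXn2 _ 2) ?normR_ge0 //; apply/eqP.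
    by rewrite -!(ipRxx hH) /ipR (Gip _ _ _ _ g g).
have [z Mz hz|z Nz hz|U uU _] := isometric_extension hH cM cN iG; last by exists U.
- by apply: bE => // e Ee; exact: hz (Gphi _ Ee).
- by apply: bF => // f /phiS[e Ee <-]; exact: hz (Gphi _ Ee).
Qed.

Lemma eq_hdim_sym M N : eq_hdim ip M N -> eq_hdim ip N M.
Proof. by case=> E [F [? ? ?]]; exists F, E; split; rewrite // card_eq_sym. Qed.

Context (P Q : {linear H -> H}).
Context (PP : forall x, P (P x) = P x) (sP : forall x y, ip (P x) y = ip x (P y)).
Context (QQ : forall x, Q (Q x) = Q x) (sQ : forall x y, ip (Q x) y = ip x (Q y)).

Lemma direct_rotation_exists_iff :
  (exists S : H -> H, direct_rotation ip P Q S) <-> eq_hdim ip (H2 P Q) (H3 P Q).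
Proof.
have [B hB] := cos_exists hH PP sP QQ sQ.
have c2 := closed_H2 hH PP sP QQ sQ; have c3 := closed_H3 hH PP sP QQ sQ.
split => [[S dS]|/eq_hdim_sym /(eq_hdim_unitary c3 c2)[C uC]].
  apply: eq_hdim_sym; apply: (unitary_eq_hdim c3 c2).
  apply: (direct_rotation_unitary hH PP sP QQ sQ hB dS).
by have [S [dS _ _]] := rotation_exists hH PP sP QQ sQ hB uC; exists S.
Qed.

End Dimension.

(** * Square roots on invariant subspaces *)

Section SquareRootOnSubspace.
Local Open Scope complex_scope.
Context (R : realType) (H : completeNormedModType R[i]).
Context (ip : {dot H for @Num.conj R[i]}) (hH : hilbert_norm ip).
Implicit Types (x y z : H) (M N : set H) (F : H -> H).

Lemma closed_orthogonal N : closed_subspace [set x | forall y, N y -> ip x y = 0].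
Proof.
split=> [y _|a x x' hx hx' y Ny|x hx y Ny]; first by rewrite ip0l.
  by rewrite ipDl ipZl hx // hx' // mulr0 addr0.
have key z : (forall x', (forall y, N y -> ip x' y = 0) -> ipR ip x' z = 0) -> ipR ip x z = 0.
  move=> h; apply/eqP; rewrite -normr_le0; apply/ler_addgt0Pr => e e0; rewrite add0r.
  have z0 : 0 < normR z + 1 by apply: ltr_wpDl => //; exact: normR_ge0.
  have [|x' hx' xx'] := hx (e / (normR z + 1)); first by rewrite divr_gt0.
  have -> : ipR ip x z = ipR ip (x - x') z by rewrite !ipRE (h _ hx') subr0.
  apply: le_trans (ipR_CauchySchwarz hH _ _) _.
  move: xx'; rewrite ltr_pdivlMr //; have := normR_ge0 (x - x'); have := normR_ge0 z; nra.
rewrite ip_ipR !key //; first by move=> x' hx'; rewrite /ipR ipZr hx' // mulr0.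
by move=> x' hx'; rewrite /ipR hx'.
Qed.

Lemma closed_ominus M N : closed_subspace M -> closed_subspace (ominus ip M N).
Proof. by move=> cM; apply: closed_subspaceI => //; exact: closed_orthogonal. Qed.

Context (F : H -> H) (B : {linear H -> H}) (hB : commutant_sqrt ip F B).
Context (M : set H) (cM : closed_subspace M) (FM : forall x, M x -> M (F x)).

Lemma sqrt_on_in x : M x -> M (B x).
Proof. by case: hB => _ _ _ /(_ M cM FM)[+ _]; apply. Qed.

(** r commutes with F = r^2 on M, hence with B there, so uniqueness of positive
    square roots applies on M. *)
Lemma sqrt_on_unique r : is_sqrt ip M F r -> forall x, M x -> r x = B x.
Proof.
move=> [br pr rr]; case: (hB) => pB bB BB /(_ M cM FM)[BM com].
have bBM : bounded_op M M B.
  have /bounded_linearP[_ [k k0 hk]] := bB.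
  by apply/bounded_opP; split => // [a x y _ _|]; [exact: linearP|exists k].
have rM := op_in br.
have comr z : M z -> r (B z) = B (r z).
  apply: com => // w Mw; rewrite -!rr //; exact: rM.
move=> x Mx; apply: (positive_sqrt_unique hH cM br pr bBM _ _ comr Mx).
  by move=> z _; exact: pB.
by move=> z Mz; rewrite rr // BB.
Qed.

Lemma op_sqrt_on F' : (forall x, M x -> F' x = F x) ->
  forall x, M x -> op_sqrt ip M F' x = B x.
Proof.
move=> FF'; apply: sqrt_on_unique; case: (hB) => pB bB BB _.
have sB : is_sqrt ip M F' B.
  split=> [|x _|x Mx]; [|exact: pB|by rewrite BB FF'].
  have /bounded_linearP[_ [k k0 hk]] := bB.
  apply/bounded_opP; split => [x|a x y _ _|]; [exact: sqrt_on_in|exact: linearP|].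
  by exists k.
have [b p e] : is_sqrt ip M F' (op_sqrt ip M F').
  by rewrite /op_sqrt; case: xgetP => [_ -> //|/(_ _ sB)].
by split => // x Mx; rewrite e // FF'.
Qed.

End SquareRootOnSubspace.

(** * Operator matrices of direct rotations *)

Section OperatorMatrices.
Local Open Scope complex_scope.
Context (R : realType) (H : completeNormedModType R[i]).
Context (ip : {dot H for @Num.conj R[i]}) (hH : hilbert_norm ip).
Implicit Types (x y z : H) (M N : set H).
Context (P Q : {linear H -> H}).
Context (PP : forall x, P (P x) = P x) (sP : forall x y, ip (P x) y = ip x (P y)).
Context (QQ : forall x, Q (Q x) = Q x) (sQ : forall x y, ip (Q x) y = ip x (Q y)).
Local Notation T := (transfer P Q).
Local Notation A := (cos_square P Q).
Local Notation K1 := (H1 P Q).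
Local Notation K2 := (H2 P Q).
Local Notation K3 := (H3 P Q).
Local Notation K4 := (H4 P Q).
Local Notation K5 := (H5 ip P Q).
Local Notation K6 := (H6 ip P Q).

(** Valid for the default value 0 as well, so it can be used before the square
    root is known to exist. *)
Lemma op_sqrt_in M F x : M 0 -> M x -> M (op_sqrt ip M F x).
Proof. by move=> M0 Mx; rewrite /op_sqrt; case: xgetP => // B _ [/op_in h _ _]; exact: h. Qed.

Lemma op_sqrt0 M F : closed_subspace M -> op_sqrt ip M F 0 = 0.
Proof. by move=> cM; rewrite /op_sqrt; case: xgetP => // B _ [bB _ _]; exact: (op0 cM bB). Qed.

Lemma in_H1 x : K1 x <-> P x = x /\ Q x = x.
Proof.
split=> [[/(range_projection PP) ? /(range_projection QQ) ?]|[? ?]]; split=> //.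
  exact/(range_projection PP).
exact/(range_projection QQ).
Qed.

Lemma in_H4 x : K4 x <-> P x = 0 /\ Q x = 0.
Proof. by []. Qed.

Lemma closed_H1 : closed_subspace K1.
Proof. by apply: closed_subspaceI; exact: closed_range. Qed.

Lemma closed_H4 : closed_subspace K4.
Proof. by apply: closed_subspaceI; exact: closed_ker. Qed.

Let c1 := closed_H1.
Let c2 := closed_H2 hH PP sP QQ sQ.
Let c3 := closed_H3 hH PP sP QQ sQ.
Let c4 := closed_H4.

Lemma closed_H5 : closed_subspace K5.
Proof. by apply: closed_ominus => //; exact: closed_range. Qed.

Lemma closed_H6 : closed_subspace K6.
Proof. by apply: closed_ominus. Qed.

Let c5 := closed_H5.
Let c6 := closed_H6.

Lemma in_H5 x : K5 x <->
  [/\ P x = x, forall y, K1 y -> ip x y = 0 & forall y, K2 y -> ip x y = 0].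
Proof.
split=> [[/(range_projection PP) Px h]|[Px h1 h2]].
  split=> // y Ky; apply: h.
    by exists y => //; exists 0; rewrite ?addr0 //; exact: csub0.
  by exists 0; [exact: csub0|exists y; rewrite ?add0r].
split; first exact/(range_projection PP).
by move=> _ [u Ku [v Kv <-]]; rewrite ipDr h1 // h2 // addr0.
Qed.

(** H6 is defined as the complement of all the other summands; it is the part
    of ker P orthogonal to H3 and H4, because P x lies in H5 when x is in H6. *)
Lemma in_H6 x : K6 x <->
  [/\ P x = 0, forall y, K3 y -> ip x y = 0 & forall y, K4 y -> ip x y = 0].
Proof.
split=> [[_ h]|[Px h3 h4]].
  have d M N u v : closed_subspace M -> closed_subspace N -> M u -> N v -> dsum M N (u + v).
    by move=> _ _ Mu Nv; exists u => //; exists v.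
  have g u1 u2 u3 u4 u5 : K1 u1 -> K2 u2 -> K3 u3 -> K4 u4 -> K5 u5 ->
      ip x (u1 + u2 + u3 + u4 + u5) = 0.
    move=> k1 k2 k3 k4 k5; apply: h; exists (u1 + u2 + u3 + u4); last by exists u5.
    exists (u1 + u2 + u3); last by exists u4.
    by exists (u1 + u2); [exists u1 => //; exists u2|exists u3].
  have z1 := csub0 c1; have z2 := csub0 c2; have z3 := csub0 c3.
  have z4 := csub0 c4; have z5 := csub0 c5.
  split.
  - have k5 : K5 (P x).
      apply/in_H5; split; first exact: PP.
        move=> y k1; have /in_H1[Py _] := k1; rewrite sP Py.
        by have := g y 0 0 0 0 k1 z2 z3 z4 z5; rewrite !addr0.
      move=> y k2; have /(in_H2 Q PP)[Py _] := k2; rewrite sP Py.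
      by have := g 0 y 0 0 0 z1 k2 z3 z4 z5; rewrite !addr0 add0r.
    apply: (ip_eq0 (ip := ip)); rewrite sP PP.
    by have := g 0 0 0 0 (P x) z1 z2 z3 z4 k5; rewrite !addr0 add0r.
  - by move=> y k3; have := g 0 0 y 0 0 z1 z2 k3 z4 z5; rewrite !addr0 add0r.
  - by move=> y k4; have := g 0 0 0 y 0 z1 z2 z3 k4 z5; rewrite !addr0 add0r.
split=> // _ [_ [_ [_ [u1 k1 [u2 k2 <-]] [u3 k3 <-]] [u4 k4 <-]] [u5 k5 <-]].
have z u : P u = u -> ip x u = 0 by move=> <-; rewrite -sP Px ip0l.
have /in_H1[/z e1 _] := k1; have /(in_H2 Q PP)[/z e2 _] := k2.
have /in_H5[/z e5 _ _] := k5.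
by rewrite !ipDr e1 e2 (h3 _ k3) (h4 _ k4) e5 !addr0.
Qed.

Lemma decomposition_sum x : exists x1 x2 x3 x4 x5 x6,
  [/\ K1 x1, K2 x2 & K3 x3] /\ [/\ K4 x4, K5 x5 & K6 x6] /\
  x = x1 + x2 + x3 + x4 + x5 + x6.
Proof.
have [x1 k1 o1] := projection_theorem hH (P x) c1.
have [x2 k2 o2] := projection_theorem hH (P x) c2.
have [x3 k3 o3] := projection_theorem hH (x - P x) c3.
have [x4 k4 o4] := projection_theorem hH (x - P x) c4.
have QO u v : Q u = u -> Q v = 0 -> ip u v = 0 /\ ip v u = 0.
  by move=> Qu Qv; rewrite -{1}Qu -{2}Qu -sQ sQ Qv ip0l ip0r.
have [Px1 Qx1] := (in_H1 x1).1 k1; have [Px2 Qx2] := (in_H2 Q PP x2).1 k2.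
have [Px3 Qx3] := (in_H3 P QQ x3).1 k3; have [Px4 Qx4] := (in_H4 x4).1 k4.
exists x1, x2, x3, x4, (P x - x1 - x2), (x - P x - x3 - x4).
split=> //; split; last by vec ip.
split=> //.
- apply/in_H5; split; first by rewrite !linearB /= PP Px1 Px2.
  + move=> y ky; have [_ Qy] := (in_H1 y).1 ky.
    have [_ e] := QO _ _ Qy Qx2.
    by rewrite ipDl ipNl e (o1 _ ky) subrr.
  + move=> y ky; have [_ Qy] := (in_H2 Q PP y).1 ky.
    have [e _] := QO _ _ Qx1 Qy.
    by rewrite addrAC ipDl ipNl e (o2 _ ky) subrr.
- apply/in_H6; split; first by rewrite !linearB /= PP Px3 Px4 !subrr.
  + move=> y ky; have [_ Qy] := (in_H3 P QQ y).1 ky.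
    have [_ e] := QO _ _ Qy Qx4.
    by rewrite ipDl ipNl e (o3 _ ky) subrr.
  + move=> y ky; have [_ Qy] := (in_H4 y).1 ky.
    have [e _] := QO _ _ Qx3 Qy.
    by rewrite addrAC ipDl ipNl e (o4 _ ky) subrr.
Qed.

Context (B : {linear H -> H}) (hB : commutant_sqrt ip A B).

Section GenericPart.
Context (S : H -> H) (dS : direct_rotation ip P Q S).

(** Both sides agree after applying S, by S^2 = 2 S B - 1. *)
Lemma direct_rotation_commute x : S (B x) = B (S x).
Proof.
have uS : unitary_op ip setT setT S by case: dS.
have cT := @closed_subspace_setT _ H.
have SB := direct_rotation_cos hH sP sQ hB dS.
have sq z : S (S z) = S (B z) + S (B z) - z.
  by rewrite (direct_rotation_sqr dS) SB.
apply: (direct_rotation_inj dS).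
have [S' SE] := linear_pack (proj1 (proj1 (bounded_linearP S) (unitary_bounded uS))).
have := congr1 S (sq x); rewrite sq SE !(linearB, linearD) /= -SE.
move/addIr => e; have := congr1 (fun z => 2^-1 *: z) e.
by rewrite /= !half_addvv => ->.
Qed.

(** B (S x - y) = S B x - T x = 0, while S x - y is orthogonal to ker B = H2 + H3,
    a subspace that S preserves. *)
Lemma direct_rotation_generic x y :
  (forall u, K2 u \/ K3 u -> ip x u = 0) -> (forall u, K2 u \/ K3 u -> ip y u = 0) ->
  B y = T x -> S x = y.
Proof.
move=> xO yO By; have uS : unitary_op ip setT setT S by case: dS.
have cT := @closed_subspace_setT _ H.
have Bd : B (S x - y) = 0.
  by rewrite linearB /= -direct_rotation_commute By (direct_rotation_cos hH sP sQ hB dS) subrr.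
have ortho u : K2 u \/ K3 u -> ip (S x) u = 0.
  move=> ku; have Bu : B u = 0.
    by case: ku => [/(H2_cos_ker PP QQ hB)|/(H3_cos_ker PP QQ hB)].
  have SS := direct_rotation_ker_sqr hH PP sP QQ sQ hB dS Bu.
  have e : u = S (- S u) by rewrite (opN cT (unitary_bounded uS)) // SS opprK.
  rewrite e (unitary_ip cT cT uS) // (unitaryK uS) // ipNr xO ?oppr0 //.
  case: ku => k; [right|left].
    exact: (direct_rotation_H2 hH PP sP QQ sQ hB dS k).
  exact: (direct_rotation_H3 hH PP sP QQ sQ hB dS k).
have [h2 h3] := cos_ker_H23 hH PP sP QQ sQ hB Bd.
apply/eqP; rewrite -subr_eq0; apply/eqP; apply: (ip_eq0 (ip := ip)).
have e : S x - y = P (S x - y) + (S x - y - P (S x - y)) by rewrite [RHS]addrC subrK.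
rewrite {2}e ipDr !(ipDl, ipNl).
by rewrite (ortho _ (or_introl h2)) (ortho _ (or_intror h3)) (yO _ (or_introl h2)) (yO _ (or_intror h3)) !subrr addr0.
Qed.

End GenericPart.

(** For y := B x - x one has B y = - y, so positivity of B forces y = 0. *)
Lemma cos_fixed x : A x = x -> B x = x.
Proof.
move=> Ax; pose y := B x - x.
have h : ip (B y) y + ip y y = 0.
  have e : B y = - y by rewrite /y linearB /= (cos_sqr hB) Ax opprB.
  by rewrite e ipNl addNr.
have pB : positive_op ip setT B by case: hB.
apply/eqP; rewrite -subr_eq0 -/y; apply/eqP; apply: (ip_eq0 (ip := ip)).
apply/eqP; rewrite eq_le ip_ge0 andbT; move/eqP: h; rewrite addrC addr_eq0 => /eqP ->.
by rewrite oppr_le0 pB.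
Qed.

Context (Q0 D : H -> H) (bQ0 : bounded_op K5 K5 Q0).
Context (uD : unitary_op ip K6 K5 D).
Context (mQ : has_opmx (decomposition ip P Q) (Q_opmx ip K5 K6 Q0 D) Q).
Local Notation r := (op_sqrt ip K5 Q0).
Local Notation r' := (op_sqrt ip K5 (idfun - Q0)).
Local Notation D' := (adj_op ip K6 K5 D).

Let bD := unitary_bounded uD.
Let bD' := unitary_adj_bounded hH c6 c5 uD.
Let zero_fun x : (0 : H -> H) x = 0. Proof. by []. Qed.
Let opp_fun (f : H -> H) x : (- f) x = - f x. Proof. by []. Qed.

(** The first four components vanish, leaving the lower right 2 x 2 block. *)
Lemma Q_H56 x5 x6 : K5 x5 -> K6 x6 ->
  Q (x5 + x6) = Q0 x5 + r (r' (D x6)) + D' (r (r' x5)) + D' (D x6 - Q0 (D x6)).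
Proof.
move=> k5 k6; have [_ h] := mQ.
have := h (fun j => nth 0 [:: 0; 0; 0; 0; x5; x6] j).
rewrite !big_ord_recl !big_ord0 /= !zero_fun !(add0r, addr0) => ->; last first.
  by case=> [[|[|[|[|[|[|//]]]]]] ?] //=; exact: csub0.
by rewrite !addrA.
Qed.

Let sqrt_in F x : K5 x -> K5 (op_sqrt ip K5 F x).
Proof. by move=> k; apply: op_sqrt_in => //; exact: csub0. Qed.

Lemma Q_H5 x : K5 x -> Q x = Q0 x + D' (r (r' x)).
Proof.
move=> k5; have := Q_H56 k5 (csub0 c6).
rewrite addr0 (op0 c6 bD) (op0 c5 bQ0) subr0 (op0 c5 bD') addr0.
by rewrite !op_sqrt0 // addr0.
Qed.

Lemma Q_H6 x : K6 x -> Q x = r (r' (D x)) + D' (D x - Q0 (D x)).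
Proof.
move=> k6; have := Q_H56 (csub0 c5) k6.
by rewrite add0r (op0 c5 bQ0) !op_sqrt0 // (op0 c5 bD') addr0 add0r.
Qed.

(** For x in ran P one has A x = P Q x, the H5 component of Q x. *)
Lemma cos_square_H5 x : K5 x -> A x = Q0 x.
Proof.
move=> k5; have [Px _ _] := (in_H5 x).1 k5.
have [P0 _ _] := (in_H5 _).1 (op_in bQ0 k5).
have [P1 _ _] := (in_H6 _).1 (op_in bD' (sqrt_in Q0 (sqrt_in (idfun - Q0) k5))).
have e : P (Q x) = Q0 x by rewrite Q_H5 // linearD /= P0 P1 addr0.
by rewrite /cos_square Px e subrr sub0r addrAC addNr add0r.
Qed.

(** For x in ker P one has A x = x - (1-P) Q x, and D* (1 - Q0) D x is the H6
    component of Q x. *)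
Lemma cos_square_H6 x : K6 x -> A x = D' (Q0 (D x)).
Proof.
move=> k6; have [Px _ _] := (in_H6 x).1 k6.
have kD := op_in bD k6; have kQ := op_in bQ0 kD.
have [P0 _ _] := (in_H5 _).1 (sqrt_in Q0 (sqrt_in (idfun - Q0) kD)).
have [P1 _ _] := (in_H6 _).1 (op_in bD' (csubB c5 kD kQ)).
have e : P (Q x) = r (r' (D x)) by rewrite Q_H6 // linearD /= P0 P1 addr0.
rewrite /cos_square Px e (linear0 Q) subr0 addr0 Q_H6 // (opB c5 bD') // (unitaryK uD) //.
by vec ip.
Qed.

Let A5 x : K5 x -> K5 (A x).
Proof. by move=> k; rewrite cos_square_H5 //; exact: (op_in bQ0). Qed.

Let A6 x : K6 x -> K6 (A x).
Proof. by move=> k; rewrite cos_square_H6 //; apply: (op_in bD'); apply: (op_in bQ0); exact: (op_in bD k). Qed.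

Lemma cos_H5 x : K5 x -> r x = B x.
Proof. by apply: (op_sqrt_on hH hB c5 A5) => z k; rewrite cos_square_H5. Qed.

(** D* Q0^(1/2) D is a positive square root of D* Q0 D because D D* = 1 on H5. *)
Lemma cos_H6 x : K6 x -> D' (r (D x)) = B x.
Proof.
move=> k6; apply: (sqrt_on_unique hH hB c6 A6 (r := fun z => D' (r (D z)))) => //.
have K5D z : K6 z -> K5 (D z) by move=> kz; exact: (op_in bD kz).
have /bounded_opP[_ lD [k k0 hk]] := bD.
have /bounded_opP[_ lD' [l l0 hl]] := bD'.
have /bounded_linearP[_ [m m0 hm]] := cos_bounded hB.
have B5 z : K5 z -> K5 (B z) by exact: (sqrt_on_in hB c5 A5).
have pB : positive_op ip setT B by case: hB.
have rB z : K6 z -> D' (r (D z)) = D' (B (D z)) by move=> kz; rewrite cos_H5 //; exact: K5D.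
have K6B z : K6 z -> K6 (D' (B (D z))).
  by move=> kz; apply: (op_in bD'); apply: B5; exact: K5D.
split.
- apply/bounded_opP; split; first by move=> z kz; rewrite rB //; exact: K6B.
    move=> a z w kz kw; rewrite !rB //; last by case: c6 => _ + _; apply.
    by rewrite lD // linearP lD' //; apply: B5; exact: K5D.
  exists (l * (m * k)); first by rewrite !mulr_ge0.
  move=> z kz; rewrite rB //; apply: le_trans (hl _ (B5 _ (K5D _ kz))) _.
  rewrite -!mulrA ler_wpM2l //; apply: le_trans (hm _) _.
  by rewrite ler_wpM2l //; exact: hk.
- move=> z kz; rewrite rB // ipC -(unitary_ip c6 c5 uD) //; last by apply: B5; exact: K5D.
  by rewrite -ipC; exact: pB.
- move=> z kz; rewrite !rB //; last exact: K6B.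
  rewrite (unitaryVK uD); last by apply: B5; exact: K5D.
  by rewrite (cos_sqr hB) cos_square_H5 ?cos_square_H6 //; exact: K5D.
Qed.

Let ortho5 x u : K5 x -> K2 u \/ K3 u -> ip x u = 0.
Proof.
move=> /in_H5[Px _ h] [/h //|/(in_H3 P QQ)[Pu _]].
by rewrite -Px sP Pu ip0r.
Qed.

Let ortho6 x u : K6 x -> K2 u \/ K3 u -> ip x u = 0.
Proof.
move=> /in_H6[Px h _] [/(in_H2 Q PP)[Pu _]|/h //].
by rewrite -Pu -sP Px ip0l.
Qed.

Section Columns.
Context (S : H -> H) (dS : direct_rotation ip P Q S).

Let generic := direct_rotation_generic dS.

Lemma direct_rotation_H1 x : K1 x -> S x = x.
Proof.
move=> /in_H1[Px Qx]; have h u : K2 u \/ K3 u -> ip x u = 0.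
  move=> [/(in_H2 Q PP)[_ Qu]|/(in_H3 P QQ)[Pu _]].
    by rewrite -Qx sQ Qu ip0r.
  by rewrite -Px sP Pu ip0r.
have Tx : T x = x by rewrite /transfer Px Qx subrr (linear0 Q) subrr addr0.
have Ax : A x = x by rewrite /cos_square Px Qx Px subrr sub0r addNr add0r.
by apply: generic => //; rewrite (cos_fixed Ax).
Qed.

Lemma direct_rotation_H4 x : K4 x -> S x = x.
Proof.
move=> /in_H4[Px Qx]; have h u : K2 u \/ K3 u -> ip x u = 0.
  move=> [/(in_H2 Q PP)[Pu _]|/(in_H3 P QQ)[_ Qu]].
    by rewrite -Pu -sP Px ip0l.
  by rewrite -Qu -sQ Qx ip0l.
have Tx : T x = x by rewrite /transfer Px (linear0 Q) subr0 Qx subr0 add0r.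
have Ax : A x = x by rewrite /cos_square Px Qx (linear0 P) (linear0 Q) !subr0 !addr0.
by apply: generic => //; rewrite (cos_fixed Ax).
Qed.

(** B sends the right-hand side to Q0 x + D* Q0^(1/2) (1 - Q0)^(1/2) x = Q x,
    which is T x since P x = x. *)
Lemma direct_rotation_H5 x : K5 x -> S x = r x + D' (r' x).
Proof.
move=> k5; have kr := sqrt_in Q0 k5; have kr' := sqrt_in (idfun - Q0) k5.
have kD := op_in bD' kr'.
apply: generic => [u|u ku|]; first exact: ortho5.
  by rewrite ipDl ortho5 // ortho6 // addr0.
have [Px _ _] := (in_H5 x).1 k5.
rewrite linearD /= -(cos_H6 kD) (unitaryVK uD) // (cos_H5 k5) (cos_sqr hB) cos_square_H5 //.
by rewrite /transfer Px subrr (linear0 Q) subrr addr0 Q_H5.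
Qed.

(** B sends the right-hand side to
    - Q0^(1/2) (1 - Q0)^(1/2) D x + D* Q0 D x = x - Q x, which is T x since P x = 0. *)
Lemma direct_rotation_H6 x : K6 x -> S x = - r' (D x) + D' (r (D x)).
Proof.
move=> k6; have kx := op_in bD k6.
have kr := sqrt_in Q0 kx; have kr' := sqrt_in (idfun - Q0) kx.
have kD := op_in bD' kr.
apply: generic => [u|u ku|]; first exact: ortho6.
  by rewrite ipDl ipNl ortho5 // ortho6 // oppr0 addr0.
have [Px _ _] := (in_H6 x).1 k6; have kQ := op_in bQ0 kx.
rewrite linearD linearN /= -(cos_H5 kr') (cos_H6 k6) (cos_sqr hB) cos_square_H6 //.
rewrite /transfer Px (linear0 Q) subr0 add0r Q_H6 // (opB c5 bD') // (unitaryK uD) //.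
by vec ip.
Qed.

End Columns.

(** The 36 matrix entries reduce to the nonzero ones. *)
Lemma S_opmxP C S : has_opmx (decomposition ip P Q) (S_opmx ip K2 K3 K5 K6 Q0 D C) S <->
  [/\ forall x, K3 x -> K2 (C x), forall x, K2 x -> K3 (adj_op ip K3 K2 C x) &
  forall x1 x2 x3 x4 x5 x6, K1 x1 -> K2 x2 -> K3 x3 -> K4 x4 -> K5 x5 -> K6 x6 ->
   S (x1 + x2 + x3 + x4 + x5 + x6) = x1 - adj_op ip K3 K2 C x2 + C x3 + x4 +
     (r x5 + D' (r' x5)) + (- r' (D x6) + D' (r (D x6)))].
Proof.
split=> [[hin hS]|[hC hC' hS]]; split.
- by move=> x k3; exact: (hin (Ordinal (isT : (1 < 6)%N)) (Ordinal (isT : (2 < 6)%N)) x k3).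
- move=> x k2; have := hin (Ordinal (isT : (2 < 6)%N)) (Ordinal (isT : (1 < 6)%N)) x k2.
  by move=> /= /(csubN c3); rewrite fctE opprK.
- move=> x1 x2 x3 x4 x5 x6 k1 k2 k3 k4 k5 k6.
  have := hS (fun j => nth 0 [:: x1; x2; x3; x4; x5; x6] j).
  rewrite !big_ord_recl !big_ord0 /= !zero_fun !(add0r, addr0) !addrA => ->; last first.
    by case=> [[|[|[|[|[|[|//]]]]]] ?].
  rewrite !opp_fun /=; vec ip.
- case=> [[|[|[|[|[|[|//]]]]]] ?]; case=> [[|[|[|[|[|[|//]]]]]] ?] x //= k;
    try exact: csub0; rewrite ?zero_fun; try exact: csub0.
  + exact: hC.
  + by apply: (csubN c3); exact: hC'.
  + exact: sqrt_in.
  + by apply: (csubN c5); apply: sqrt_in; exact: (op_in bD k).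
  + by apply: (op_in bD'); exact: sqrt_in.
  + by apply: (op_in bD'); apply: sqrt_in; exact: (op_in bD k).
- move=> x hx; rewrite !big_ord_recl !big_ord0 /= !zero_fun !(add0r, addr0) !addrA.
  rewrite hS; [|exact: (hx (@ord0 5))|exact: (hx (lift ord0 (@ord0 4)))|exact: (hx (lift ord0 (lift ord0 (@ord0 3))))|exact: (hx (lift ord0 (lift ord0 (lift ord0 (@ord0 2)))))|exact: (hx (lift ord0 (lift ord0 (lift ord0 (lift ord0 (@ord0 1))))))|exact: (hx (lift ord0 (lift ord0 (lift ord0 (lift ord0 (lift ord0 (@ord0 0)))))))].
  rewrite !opp_fun /=; vec ip.
Qed.

(** The column formulas hold for every direct rotation, so given C the operator
    with the matrix of C coincides with the direct rotation built from C. *)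
Lemma direct_rotation_opmxP S : direct_rotation ip P Q S <->
  exists2 C : H -> H, unitary_op ip K3 K2 C &
    has_opmx (decomposition ip P Q) (S_opmx ip K2 K3 K5 K6 Q0 D C) S.
Proof.
have formula S' C : direct_rotation ip P Q S' ->
    (forall x, K3 x -> S' x = C x) -> (forall x, K2 x -> S' x = - adj_op ip K3 K2 C x) ->
    forall x1 x2 x3 x4 x5 x6, K1 x1 -> K2 x2 -> K3 x3 -> K4 x4 -> K5 x5 -> K6 x6 ->
   S' (x1 + x2 + x3 + x4 + x5 + x6) = x1 - adj_op ip K3 K2 C x2 + C x3 + x4 +
     (r x5 + D' (r' x5)) + (- r' (D x6) + D' (r (D x6))).
  move=> dS e3 e2 x1 x2 x3 x4 x5 x6 k1 k2 k3 k4 k5 k6.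
  have uS : unitary_op ip setT setT S' by case: dS.
  rewrite !(opD (unitary_bounded uS)) // (e3 _ k3) (e2 _ k2).
  rewrite (direct_rotation_H1 dS k1) (direct_rotation_H4 dS k4).
  by rewrite (direct_rotation_H5 dS k5) (direct_rotation_H6 dS k6).
split=> [dS|[C uC /S_opmxP[_ _ hS]]].
  have uC := direct_rotation_unitary hH PP sP QQ sQ hB dS.
  exists S => //; apply/S_opmxP; split.
  - by move=> x k3; exact: (direct_rotation_H3 hH PP sP QQ sQ hB dS k3).
  - by move=> x k2; exact: (unitary_adj_in c3 c2 uC).
  - apply: formula => // x k2.
    by rewrite (direct_rotation_adj hH PP sP QQ sQ hB dS) // opprK.
have [S' [dS' e3 e2]] := rotation_exists hH PP sP QQ sQ hB uC.
suff -> : S = S' by [].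
apply/funext => x.
have [x1 [x2 [x3 [x4 [x5 [x6 [[k1 k2 k3] [[k4 k5 k6] ->]]]]]]]] := decomposition_sum x.
by rewrite hS // (formula _ _ dS' e3 e2).
Qed.

End OperatorMatrices.

Theorem theorem4p3 (R : realType) (H : completeNormedModType R[i])
    (ip : {dot H for @Num.conj R[i]}) (hH : hilbert_norm ip)
    (P Q : H -> H)
    (hP : orthogonal_projection ip P) (hQ : orthogonal_projection ip Q) :
  ((exists S : H -> H, direct_rotation ip P Q S) <->
     eq_hdim ip (range P `&` op_ker Q) (op_ker P `&` range Q)) /\
  (eq_hdim ip (range P `&` op_ker Q) (op_ker P `&` range Q) ->
   forall Q0 D : H -> H,
     positive_contraction ip (H5 ip P Q) Q0 ->
     ~ op_eigenvalue (H5 ip P Q) Q0 0 ->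
     ~ op_eigenvalue (H5 ip P Q) Q0 1 ->
     unitary_op ip (H6 ip P Q) (H5 ip P Q) D ->
     has_opmx (decomposition ip P Q) (P_opmx H) P ->
     has_opmx (decomposition ip P Q)
       (Q_opmx ip (H5 ip P Q) (H6 ip P Q) Q0 D) Q ->
   forall S : H -> H,
     direct_rotation ip P Q S <->
     exists2 C : H -> H, unitary_op ip (H3 P Q) (H2 P Q) C &
       has_opmx (decomposition ip P Q)
         (S_opmx ip (H2 P Q) (H3 P Q) (H5 ip P Q) (H6 ip P Q) Q0 D C) S).
Proof.
have [P' [PE PP sP]] := orthogonal_projection_linear hP.
have [Q' [QE QQ sQ]] := orthogonal_projection_linear hQ.
subst P Q; split; first exact: (direct_rotation_exists_iff hH PP sP QQ sQ).
move=> _ Q0 D [bQ0 _ _] _ _ uD _ mQ S.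
have [B hB] := cos_exists hH PP sP QQ sQ.
exact: (direct_rotation_opmxP hH PP sP QQ sQ hB bQ0 uD mQ).
Qed.
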